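(* Let $C_{5,1}\subset\mathbb{P}^2$ be the configuration of $11$ points defined in the context. Then $H_{2C_{5,1}}$ is the smallest Hilbert function among those of double point schemes whose support is a set of $11$ points with generic Hilbert function. That is, for every set $\mathbb{X}\in\chi(H_{gen,11})$, $$H_{2C_{5,1}}(t)\le H_{2\mathbb{X}}(t)\quad\text{for every } t\in\mathbb{N}.$$
   Context: Let $k$ be an algebraically closed field of characteristic $0$, $R=k[x,y,z]$ with the standard grading, and $\mathbb{P}^2=\mathbb{P}^2_k$. For a homogeneous ideal $I\subset R$, the Hilbert function of $R/I$ is $H_{R/I}(t)=\dim_k R_t-\dim_k I_t$ for $t\in\mathbb{N}=\{0,1,2,\dots\}$. For a finite set $\mathbb{X}=\{P_1,\dots,P_s\}$ of $s$ distinct points of $\mathbb{P}^2$, let $\wp_i\subset R$ be the homogeneous prime ideal of $P_i$. Put $I_{\mathbb{X}}=\wp_1\cap\cdots\cap\wp_s$ and $H_{\mathbb{X}}=H_{R/I_{\mathbb{X}}}$. The double point scheme $2\mathbb{X}$ supported on $\mathbb{X}$ is the scheme defined by $I_{2\mathbb{X}}=\wp_1^2\cap\cdots\cap\wp_s^2$, and $H_{2\mathbb{X}}=H_{R/I_{2\mathbb{X}}}$. The generic Hilbert function of $s$ points is $H_{gen,s}(t)=\min\{s,\binom{t+2}{2}\}$, and $\chi(H_{gen,s})$ is the set of all sets $\mathbb{X}$ of $s$ distinct points of $\mathbb{P}^2$ with $H_{\mathbb{X}}=H_{gen,s}$. Configuration $C_{5,1}$: let $L_1,\dots,L_6$ be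 six general lines in $\mathbb{P}^2$ (so each $L_i$ meets the remaining five lines in $5$ distinct points), and let $C_6$ be the set of the $15$ intersection points of these lines. $C_{5,1}$ is obtained from $C_6$ by removing $4$ of the $5$ intersection points lying on $L_6$. Thus $C_{5,1}$ consists of the $10$ pairwise intersection points of $L_1,\dots,L_5$ together with one point $L_6\cap L_i$ for some $i\le 5$. It is known that $C_{5,1}\in\chi(H_{gen,11})$ and that the values $H_{2C_{5,1}}(t)$ for $t=0,1,2,\dots$ are $1,3,6,10,15,21,26,31,32,33$, and $33$ for all $t\ge 9$. *)

(* Defs.v *)
From mathcomp Require Import all_boot all_order all_algebra finmap boolp.
From mathcomp Require Import mpoly.

Set Implicit Arguments.
Unset Strict Implicit.
Unset Printing Implicit Defensive.

Import GRing.Theory.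
Local Open Scope ring_scope.

(* Ideals are Prop-valued predicates on the ring. *)

Definition is_ideal (R : comNzRingType) (I : R -> Prop) : Prop :=
  I 0 /\ forall a f g : R, I f -> I g -> I (a * f + g).

Definition ideal_gen (R : comNzRingType) (S : R -> Prop) (f : R) : Prop :=
  exists (n : nat) (a g : 'I_n -> R),
    (forall i, S (g i)) /\ f = \sum_(i < n) a i * g i.

Definition ideal_sqr (R : comNzRingType) (I : R -> Prop) : R -> Prop :=
  ideal_gen (fun f => exists g h : R, [/\ I g, I h & f = g * h]).

Lemma ideal_gen_is_ideal (R : comNzRingType) (S : R -> Prop) :
  is_ideal (ideal_gen S).
Proof.
split; first by exists 0%N, (fun=> 0), (fun=> 0); split=> [[]|]; rewrite ?big_ord0.
move=> c _ _ [m [a [u [Su ->]]]] [n [b [v [Sv ->]]]].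
exists (m + n)%N.
exists (fun i => match split i with inl j => c * a j | inr j => b j end).
exists (fun i => match split i with inl j => u j | inr j => v j end).
split=> [i|]; first by case: (split i).
rewrite big_split_ord mulr_sumr /=; congr (_ + _).
  by apply: eq_bigr => i _; rewrite (unsplitK (inl i)) mulrA.
by apply: eq_bigr => i _; rewrite (unsplitK (inr i)).
Qed.

Section Plane.
Variable k : closedFieldType.

Local Notation R := {mpoly k[3]}.

(* Points and lines of P^2 are the one- and two-dimensional subspaces of k^3. *)

Definition P2 := {U : {vspace 'rV[k]_3} | \dim U == 1%N}.

Definition line := {U : {vspace 'rV[k]_3} | \dim U == 2%N}.

Definition on (P : P2) (l : line) : bool := (val P <= val l)%VS.

Definition vanishes_at (f : R) (P : P2) : Prop :=
  forall v : 'rV[k]_3, v \in val P -> f.@[fun i => v 0 i] = 0.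

Definition pt_ideal (P : P2) : R -> Prop :=
  ideal_gen (fun f => (exists d : nat, f \is d.-homog) /\ vanishes_at f P).

Definition set_ideal (X : {fset P2}) (f : R) : Prop :=
  forall P, P \in X -> pt_ideal P f.

Definition double_ideal (X : {fset P2}) (f : R) : Prop :=
  forall P, P \in X -> ideal_sqr (pt_ideal P) f.

(* I_t as a subspace of R_t.  The default value 0 is never used when I is an
   ideal: see mem_graded_piece below. *)
Definition graded_piece (I : R -> Prop) (t : nat) : {vspace dhomog 3 k t} :=
  match pselect (exists V : {vspace dhomog 3 k t},
                   forall f, f \in V <-> I (mpoly_of_dhomog f)) with
  | left e => projT1 (cid e)
  | right _ => 0%VS
  end.

Lemma mem_graded_piece (I : R -> Prop) (t : nat) (f : dhomog 3 k t) :
  is_ideal I -> f \in graded_piece I t <-> I (mpoly_of_dhomog f).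
Proof.
move=> [I0 Ilin]; rewrite /graded_piece; case: pselect => [e|]; first by case: cid.
case; pose sub (V : {vspace dhomog 3 k t}) := forall g, g \in V -> I (mpoly_of_dhomog g).
pose Q n := `[< exists2 V : {vspace dhomog 3 k t}, \dim V = n & sub V >].
have exQ : exists n, Q n.
  exists 0%N; apply/asboolP; exists 0%VS; first exact: dimv0.
  by move=> g; rewrite memv0 => /eqP ->; rewrite linear0.
have ubQ n : Q n -> (n <= \dim {: dhomog 3 k t})%N.
  by move=> /asboolP[V <- _]; apply: dimvS (subvf V).
case: (ex_maxnP exQ ubQ) => m /asboolP[V dV sV] maxm.
exists V => g; split=> [/sV//|Ig].
suff /maxm : Q (\dim (V + <[g]>)).
  rewrite -dV => le; have /eqP -> : V == (V + <[g]>)%VS.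
    by rewrite eqEdim addvSl.
  by apply: (subvP (addvSr _ _)); apply: memv_line.
apply/asboolP; exists (V + <[g]>)%VS => // h /memv_addP[u /sV Iu [w]].
move=> /vlineP[c ->] ->; rewrite addrC linearD linearZ /= -mul_mpolyC.
exact: Ilin.
Qed.

Lemma set_ideal_is_ideal (X : {fset P2}) : is_ideal (set_ideal X).
Proof.
split=> [P _|a f g If Ig P PX]; first exact: (ideal_gen_is_ideal _).1.
by apply: (ideal_gen_is_ideal _).2; [apply: If|apply: Ig].
Qed.

Lemma double_ideal_is_ideal (X : {fset P2}) : is_ideal (double_ideal X).
Proof.
split=> [P _|a f g If Ig P PX]; first exact: (ideal_gen_is_ideal _).1.
by apply: (ideal_gen_is_ideal _).2; [apply: If|apply: Ig].
Qed.

(* The Hilbert function of R/I. *)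
Definition hilbert (I : R -> Prop) (t : nat) : nat :=
  (\dim {: dhomog 3 k t} - \dim (graded_piece I t))%N.

Definition H_pts (X : {fset P2}) : nat -> nat := hilbert (set_ideal X).
Definition H_double (X : {fset P2}) : nat -> nat := hilbert (double_ideal X).

Definition H_gen (s t : nat) : nat := minn s 'C(t + 2, 2).

Definition chi_gen (s : nat) (X : {fset P2}) : Prop :=
  #|` X|%fset = s /\ forall t : nat, H_pts X t = H_gen s t.

(* "General" means that the lines are distinct and no three are concurrent,
   i.e. that distinct pairs of lines meet in distinct points. *)
Definition general_lines (n : nat) (L : 'I_n -> line) : Prop :=
  injective L /\
  forall i j l : 'I_n, uniq [:: i; j; l] ->
    forall P : P2, ~~ [&& on P (L i), on P (L j) & on P (L l)].

(* The lines L_1, ..., L_6 are indexed by 0, ..., 5; thus L_6 is L ord_max. *)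
Definition is_C51 (C : {fset P2}) : Prop :=
  exists (L : 'I_6 -> line) (m : 'I_6),
    [/\ general_lines L, (m < 5)%N &
      forall P : P2, P \in C <->
        (exists i j : 'I_6, [/\ (i < j)%N, (j < 5)%N, on P (L i) & on P (L j)])
        \/ (on P (L ord_max) /\ on P (L m))].

End Plane.

(* Main.v *)
Require Import Defs.
From mathcomp Require Import all_boot all_order all_algebra finmap.
From HB Require Import structures.
From mathcomp Require Import boolp mpoly ring zify.

Set Implicit Arguments.
Unset Strict Implicit.
Unset Printing Implicit Defensive.

Import Order.TTheory GRing.Theory.
Local Open Scope ring_scope.

(** The argument is linear algebra on gradients. Write a point as [p] with p a
    nonzero vector of k^3. A form F of positive degree is double at [p] exactly
    when its gradient vanishes at p: Euler's formula recovers the value from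
    the gradient, and modulo the square of the ideal of the point a form is
    determined by its gradient (ideal_sqr_homog). So for eleven points p_i the
    forms of degree t > 0 that are double on X are the kernel of
    F |-> (grad F (p_i))_i with values in (k^3)^11, and the dimension of that
    kernel is binomial (t+2, 2) - 33 + dim Rel_t, where Rel_t is the space of
    jet relations: families (a_i) with sum_i a_i . grad F (p_i) = 0 for all F
    of degree t.

    Let X have generic Hilbert function. Then no cubic contains X, and quartics
    separate the points: for each i there is a quartic Q_i through the other
    points and not through p_i. Relations are killed by testing them on products.

    - In degree t >= 9, the tests Q_i^2 m, with m an arbitrary linear form times
      a form that does not vanish at p_i, give Rel_t = 0.
    - Suppose that no line contains five points of X. The decisive fact is
      quartic_gradients: at each p_i the gradients of the quartics through X
      leave no direction free except the radial one, p_i itself. The tests Q_i G,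
      with G a quartic through X, give Rel_8 = 0. The tests S G, with S a cubic,
      show that a relation of degree 7 is determined by a_i0 modulo p_i0, for a
      suitable i0 whose removal leaves ten points on no cubic; so
      dim Rel_7 <= 2.
    - Suppose that a line L contains five points of X. It contains exactly
      five, and the other six separate each other by conics, since a line and a
      conic cannot cover X. Relations of degree 7 or 8 then vanish off L, are
      tangent to L, and are determined by their value at one point of L; this
      gives dim Rel_7 <= 2 and dim Rel_8 <= 1.

    Hence the forms double on X have dimension at most 5 in degree 7, at most
    13 in degree 8, and binomial (t+2, 2) - 33 in degrees t >= 9. Lower degrees
    come for free. A space V of forms with dim V >= 3 satisfies
    dim (R_1 V) >= 6, by counting leading monomials (dim_linear_multiples), so
    degree 6 has dimension at most 2; a nonzero form of degree at most 5 would
    have at least three independent multiples in degree 6, so there is none.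

    For the configuration C all these bounds are attained. With S = L_1 ... L_5,
    the forms S G with G a form through the eleventh point give dimensions 2
    and 5 in degrees 6 and 7. In degree 8 the forms L_m G do, where L_m is the
    line with five points of C: G has degree 7, passes through these five
    points and is double at the other six, which is 5 + 18 conditions on a space
    of dimension 36. Double points impose at most 33 conditions in any degree. *)

(** * Linear algebra *)

Lemma big_option (R : nmodType) (T : finType) (f : option T -> R) :
  \sum_o f o = f None + \sum_i f (Some i).
Proof.
rewrite (bigD1 None) //=; congr (_ + _).
by rewrite (reindex_omap Some id) /=; [apply: eq_bigl => i; rewrite eqxx | case].
Qed.

Section LinearAlgebra.
Variable k : fieldType.

Lemma dim_rV n : \dim {:'rV[k]_n} = n.
Proof. by rewrite dimvf /dim /= mul1n. Qed.

Lemma kernel_exists (V W : vectType k) (f : V -> W) : linear f ->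
  exists2 K : {vspace V}, (forall v, v \in K <-> f v = 0)
    & (\dim {:V} <= \dim K + \dim {:W})%N.
Proof.
move=> lf; pose fL : {linear V -> W} := HB.pack f (GRing.isLinear.Build k V W _ f lf).
exists (lker (linfun fL)) => [v|].
  by rewrite memv_ker lfunE; split=> /eqP.
rewrite -(limg_ker_dim (linfun fL) fullv) capfv leq_add2l.
exact: dimvS (subvf _).
Qed.

Lemma kernel_nonzero (V W : vectType k) (f : V -> W) : linear f ->
  (\dim {:W} < \dim {:V})%N -> exists2 v, v != 0 & f v = 0.
Proof.
move=> lf lt; have [K Kf le] := kernel_exists lf.
exists (vpick K); last by apply/Kf; apply: memv_pick.
by rewrite vpick0 -dimv_eq0; lia.
Qed.

Lemma dim_le_injective (V W : vectType k) (f : V -> W) (U : {vspace V})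
    (U' : {vspace W}) : linear f ->
  (forall v, v \in U -> f v \in U') -> (forall v, v \in U -> f v = 0 -> v = 0) ->
  (\dim U <= \dim U')%N.
Proof.
move=> lf fU inj; pose fL : {linear V -> W} := HB.pack f (GRing.isLinear.Build k V W _ f lf).
rewrite -(@limg_dim_eq _ _ _ (linfun fL) U).
  by apply: dimvS; apply/subvP => w /memv_imgP[v vU ->]; rewrite lfunE; apply: fU.
apply/eqP; rewrite -subv0; apply/subvP => v.
by rewrite memv_cap memv_ker lfunE memv0 => /andP[vU /eqP] /(inj v vU) ->.
Qed.

(** The elements of W that pair to 0 with the image of f are relations, and they
    are cut out by as many linear equations as the image has dimensions; so a
    bound r on the spaces of relations gives dim W <= rank f + r. *)
Lemma rank_relations (V W : vectType k) (f : V -> W) (B : W -> W -> k)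
    (K : {vspace V}) (r : nat) :
  linear f -> (forall w, scalar (B^~ w)) -> (forall c, scalar (B c)) ->
  (forall v, v \in K -> f v = 0) ->
  (forall U : {vspace W}, (forall c, c \in U -> forall v, B c (f v) = 0) ->
     (\dim U <= r)%N) ->
  (\dim {:W} + \dim K <= \dim {:V} + r)%N.
Proof.
move=> lf lB1 lB2 Kf rel.
pose fL : {linear V -> W} := HB.pack f (GRing.isLinear.Build k V W _ f lf).
set I := limg (linfun fL); set b := vbasis I.
have [|U UE leU] := @kernel_exists W 'rV[k]_(\dim I) (fun c => \row_j B c b`_j).
  by move=> a c d; apply/rowP => j; rewrite !mxE lB1.
have Urel c : c \in U -> forall v, B c (f v) = 0.
  move=> /UE c0 v.
  pose Bc : {scalar W} := HB.pack (B c) (GRing.isLinear.Build k W k^o _ (B c) (lB2 c)).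
  have /coord_vbasis -> : f v \in I by rewrite -[f v](lfunE fL) memv_img ?memvf.
  rewrite -[B c _]/(Bc _) linear_sum big1 // => j _; rewrite linearZ /=.
  by move/rowP/(_ j): c0; rewrite !mxE => ->; rewrite mulr0.
have := rel U Urel; rewrite dim_rV in leU.
have : (\dim K <= \dim (lker (linfun fL)))%N.
  by apply: dimvS; apply/subvP => v /Kf fv; rewrite memv_ker lfunE /= fv.
have := limg_ker_dim (linfun fL) fullv; rewrite capfv -/I.
move: leU; lia.
Qed.

Lemma dim_ffun (T : finType) (V : vectType k) :
  \dim {:{ffun T -> V}} = (#|T| * \dim {:V})%N.
Proof. by rewrite !dimvf. Qed.

Lemma dim_ffun_scalar (T : finType) : \dim {:{ffun T -> k^o}} = #|T|.
Proof. by rewrite dim_ffun dimvf /dim /= muln1. Qed.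

(** The case of rank_relations with no relation at all: independent functionals
    impose independent conditions. *)
Lemma independent_functionals (V : vectType k) (T : finType) (f : T -> V -> k)
    (K : {vspace V}) :
  (forall i, scalar (f i)) -> (forall v, v \in K -> forall i, f i v = 0) ->
  (forall c : T -> k, (forall v, \sum_i c i * f i v = 0) -> forall i, c i = 0) ->
  (#|T| + \dim K <= \dim {:V})%N.
Proof.
move=> lf K0 indep; rewrite -dim_ffun_scalar -[X in (_ <= X)%N]addn0.
apply: (@rank_relations V {ffun T -> k^o} (fun v => [ffun i => f i v])
  (fun x y => \sum_i x i * y i)).
- by move=> c v w; apply/ffunP => i; rewrite !ffunE lf.
- move=> y c x x'; rewrite mulr_sumr -big_split; apply: eq_bigr => i _.
  by rewrite !ffunE mulrDl -mulrA.
- move=> x c y y'; rewrite mulr_sumr -big_split; apply: eq_bigr => i _.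
  by rewrite !ffunE mulrDr mulrCA.
- by move=> v vK; apply/ffunP => i; rewrite !ffunE K0.
move=> U Urel; rewrite leqn0 dimv_eq0 -subv0; apply/subvP => c cU.
rewrite memv0; apply/eqP/ffunP => i; rewrite ffunE; apply: (indep c) => v.
by rewrite -[RHS](Urel c cU v); apply: eq_bigr => j _; rewrite ffunE.
Qed.
End LinearAlgebra.

(** * Values and gradients of forms *)

Section Forms.
Variables (k : fieldType) (n : nat).
Implicit Types (u v p q a : 'rV[k]_n) (F G S : {mpoly k[n]}).

Definition dot u v : k := (u *m v^T) 0 0.

Lemma dotE u v : dot u v = \sum_i u 0 i * v 0 i.
Proof. by rewrite /dot mxE; apply: eq_bigr => i _; rewrite mxE. Qed.

Lemma dotC u v : dot u v = dot v u.
Proof. by rewrite !dotE; apply: eq_bigr => i _; rewrite mulrC. Qed.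

Lemma dotDl u v w : dot (u + v) w = dot u w + dot v w.
Proof. by rewrite /dot mulmxDl mxE. Qed.

Lemma dotZl c u v : dot (c *: u) v = c * dot u v.
Proof. by rewrite /dot -scalemxAl mxE. Qed.

Lemma dotDr u v w : dot u (v + w) = dot u v + dot u w.
Proof. by rewrite !(dotC u) dotDl. Qed.

Lemma dotZr c u v : dot u (c *: v) = c * dot u v.
Proof. by rewrite !(dotC u) dotZl. Qed.

Lemma dotNl u v : dot (- u) v = - dot u v.
Proof. by rewrite -scaleN1r dotZl mulN1r. Qed.

Lemma dotBl u v w : dot (u - v) w = dot u w - dot v w.
Proof. by rewrite dotDl dotNl. Qed.

Lemma dot0l u : dot 0 u = 0.
Proof. by rewrite -[0](scale0r 0) dotZl mul0r. Qed.

Lemma dot0r u : dot u 0 = 0.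
Proof. by rewrite dotC dot0l. Qed.

Lemma dot_sumr u I (r : seq I) (P : pred I) (f : I -> 'rV[k]_n) :
  dot u (\sum_(i <- r | P i) f i) = \sum_(i <- r | P i) dot u (f i).
Proof. by elim/big_rec2: _ => [|i x y _ <-]; rewrite ?dot0r ?dotDr. Qed.

Lemma dot_delta u i : dot u (delta_mx 0 i) = u 0 i.
Proof.
rewrite dotE (bigD1 i) //= big1 ?mxE ?eqxx ?mulr1 ?addr0 // => j ji.
by rewrite mxE (negbTE ji) mulr0.
Qed.

Lemma dot_nondegenerate u : (forall v, dot u v = 0) -> u = 0.
Proof. by move=> u0; apply/rowP => i; rewrite -dot_delta u0 mxE. Qed.

Lemma exists_dot_neq0 u : u != 0 -> exists v, dot u v != 0.
Proof.
move=> nu; apply: contrapT => /forallNP nv; case/eqP: nu.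
by apply: dot_nondegenerate => v; apply: contrapT => /eqP; apply: nv.
Qed.

(** A point lying on all the hyperplanes through another point equals it. *)
Lemma proportional_of_perp p q :
  (forall v, dot v q = 0 -> dot v p = 0) -> exists c, p = c *: q.
Proof.
move=> pq; have [q0|/exists_dot_neq0[e eq]] := eqVneq q 0.
  exists 0; rewrite scale0r; apply: dot_nondegenerate => v.
  by rewrite dotC pq // q0 dot0r.
exists (dot e p / dot e q); apply/eqP; rewrite -subr_eq0; apply/eqP.
apply: dot_nondegenerate => v; rewrite dotBl dotZl.
have: dot (v - (dot v q / dot e q) *: e) p = 0.
  by apply: pq; rewrite dotBl dotZl (dotC e) in eq *; rewrite divfK ?subrr.
rewrite dotBl dotZl => /eqP; rewrite subr_eq0 => /eqP.
by rewrite (dotC p) (dotC q) => ->; ring.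
Qed.

Definition ev p F : k := F.@[fun i => p 0 i].
Definition grad p F : 'rV[k]_n := \row_i ev p F^`M(i).
(** The linear form with gradient u; a nonzero u is thus also a line of the plane. *)
Definition lin u : {mpoly k[n]} := \sum_i u 0 i *: 'X_i.

Lemma evM p F G : ev p (F * G) = ev p F * ev p G.
Proof. exact: mevalM. Qed.
Lemma evD p F G : ev p (F + G) = ev p F + ev p G.
Proof. exact: mevalD. Qed.
Lemma evB p F G : ev p (F - G) = ev p F - ev p G.
Proof. exact: mevalB. Qed.
Lemma evZ p c F : ev p (c *: F) = c * ev p F.
Proof. exact: mevalZ. Qed.
Lemma evXn p F d : ev p (F ^+ d) = ev p F ^+ d.
Proof. exact: rmorphXn. Qed.
Lemma ev_prod p I (r : seq I) (P : pred I) (F : I -> {mpoly k[n]}) :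
  ev p (\prod_(i <- r | P i) F i) = \prod_(i <- r | P i) ev p (F i).
Proof. exact: rmorph_prod. Qed.
Lemma ev_sum p I (r : seq I) (P : pred I) (F : I -> {mpoly k[n]}) :
  ev p (\sum_(i <- r | P i) F i) = \sum_(i <- r | P i) ev p (F i).
Proof. exact: rmorph_sum. Qed.

Lemma gradD p F G : grad p (F + G) = grad p F + grad p G.
Proof. by apply/rowP => i; rewrite !mxE mderivD evD. Qed.
Lemma gradZ p c F : grad p (c *: F) = c *: grad p F.
Proof. by apply/rowP => i; rewrite !mxE mderivZ evZ. Qed.
Lemma gradB p F G : grad p (F - G) = grad p F - grad p G.
Proof. by rewrite gradD -scaleN1r gradZ scaleN1r. Qed.
Lemma grad_sum p I (r : seq I) (P : pred I) (F : I -> {mpoly k[n]}) :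
  grad p (\sum_(i <- r | P i) F i) = \sum_(i <- r | P i) grad p (F i).
Proof.
elim/big_rec2: _ => [|i x y _ <-]; last by rewrite gradD.
by rewrite -[0 in LHS](scale0r 0) gradZ scale0r.
Qed.
Lemma gradM p F G : grad p (F * G) = ev p F *: grad p G + ev p G *: grad p F.
Proof.
by apply/rowP => i; rewrite !mxE mderivM evD !evM addrC; congr (_ + _); rewrite mulrC.
Qed.

Lemma ev_lin p u : ev p (lin u) = dot u p.
Proof.
by rewrite ev_sum dotE; apply: eq_bigr => i _; rewrite evZ /ev mevalXU.
Qed.

Lemma grad_lin p u : grad p (lin u) = u.
Proof.
apply/rowP => j; rewrite mxE /lin linear_sum ev_sum (bigD1 j) //= big1 => [|i ij].
  rewrite mderivZ mderivX mnm1E eqxx scale1r -{1}[U_(j)%MM]add0m addmK mpolyX0.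
  by rewrite evZ /ev meval1 mulr1 addr0.
by rewrite mderivZ mderivX mnm1E (negbTE ij) scale0r scaler0 /ev meval0.
Qed.

Lemma lin_is_linear : linear lin.
Proof.
move=> c u v; rewrite /lin scaler_sumr -big_split; apply: eq_bigr => i _ /=.
by rewrite !mxE scalerDl scalerA.
Qed.

Lemma lin0 : lin 0 = 0.
Proof. by rewrite /lin big1 // => j _; rewrite mxE scale0r. Qed.

Lemma lin_eq0 u : (lin u == 0) = (u == 0).
Proof.
apply/eqP/eqP => [u0|->]; last exact: lin0.
by rewrite -(grad_lin 0 u) u0 -lin0 grad_lin.
Qed.

Lemma lin_homog u : lin u \is 1.-homog.
Proof.
by apply: rpred_sum => i _; apply: rpredZ; rewrite dhomogX /= mdeg1.
Qed.

Lemma lin_exp_homog u e : lin u ^+ e \is e.-homog.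
Proof. by have := dhomogMn e (lin_homog u); rewrite mul1n. Qed.

Lemma dhomog_cast d e F : d = e -> F \is d.-homog -> F \is e.-homog.
Proof. by move=> ->. Qed.

Lemma dhomog_mul d e F G : F \is d.-homog -> G \is e.-homog ->
  F * G \is (d + e).-homog.
Proof. exact: dhomogM. Qed.

Lemma dhomog_prod_const (I : finType) (A : {set I}) d (F : I -> {mpoly k[n]}) :
  (forall i, i \in A -> F i \is d.-homog) ->
  \prod_(i in A) F i \is (#|A| * d).-homog.
Proof.
move=> hF; rewrite -sum_nat_const.
elim/big_rec2: _ => [|i F' e Ai IH]; first exact: dhomog1.
by apply: dhomogM => //; apply: hF.
Qed.

Lemma ev_scale d F c p : F \is d.-homog -> ev (c *: p) F = c ^+ d * ev p F.
Proof.
move=> hF; rewrite /ev !mevalE mulr_sumr; apply: eq_big_seq => m mF.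
rewrite mulrCA; congr (_ * _); rewrite -(dhomog_mf hF mF) /= mdegE.
rewrite -prodrXr -big_split; apply: eq_bigr => i _.
by rewrite mxE exprMn.
Qed.

Lemma Euler d F p : F \is d.-homog -> dot p (grad p F) = d%:R * ev p F.
Proof.
move=> hF; rewrite [in LHS](mpolyE F) grad_sum [in RHS](mpolyE F) ev_sum mulr_sumr.
rewrite dot_sumr; apply: eq_big_seq => m mF.
rewrite gradZ dotZr evZ mulrCA; congr (_ * _).
rewrite -(dhomog_mf hF mF) /= mdegE natr_sum mulr_suml dotE.
apply: eq_bigr => i _; rewrite mxE mderivX evZ mulrCA.
have [->|mi] := posnP (m i); first by rewrite !mul0r.
congr (_ * _).
have {2}-> : m = (m - U_(i) + U_(i))%MM by rewrite submK // lep1mP -lt0n.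
by rewrite mpolyXD evM mulrC; congr (_ * _); rewrite /ev mevalXU.
Qed.

End Forms.

(** When S does not vanish at p, the multiples of S by linear forms realise all
    first-order jets at p. Indeed the hypothesis makes S(p) a + (a . grad S) p
    orthogonal to all m, so a = mu p, and Euler's formula turns this into
    mu (1 + s) = 0. *)
Lemma jet_faithful (k : fieldType) (n s : nat) (p a : 'rV[k]_n)
    (S : {mpoly k[n]}) : [pchar k] =i pred0 ->
  S \is s.-homog -> ev p S != 0 ->
  (forall m, dot a (grad p (S * lin m)) = 0) -> a = 0.
Proof.
move=> char0 hS S0 am.
have /dot_nondegenerate/eqP : forall m, dot (ev p S *: a + dot a (grad p S) *: p) m = 0.
  move=> m; rewrite dotDl !dotZl -[RHS](am m) gradM ev_lin grad_lin dotDr !dotZr.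
  by rewrite (dotC p m) [dot m p * _]mulrC.
rewrite addr_eq0 -scaleNr => /eqP Sa.
pose mu := - dot a (grad p S) / ev p S.
have aE : a = mu *: p by rewrite /mu mulrC -scalerA -Sa scalerA mulVf ?scale1r.
have : mu * s.+1%:R = 0.
  have := congr1 (fun x => - (x * ev p S)) (erefl mu).
  rewrite {1}/mu divfK // opprK {1}aE dotZl (Euler _ hS) => e.
  apply: (mulIf S0); rewrite mul0r -natr1 mulrDr mulr1 mulrDl -mulrA e.
  by rewrite /mu divfK // subrr.
move/eqP; rewrite mulf_eq0 ((pcharf0P k).1 char0) orbF => /eqP mu0.
by rewrite aE mu0 scale0r.
Qed.

(** * The square of the ideal of a point *)

Section PointIdeals.
Variable k : closedFieldType.
Implicit Types (P : P2 k) (p : 'rV[k]_3) (F G : {mpoly k[3]}).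

Lemma vanishes_at_ev P p F d : val P = <[p]>%VS -> F \is d.-homog ->
  ev p F = 0 -> vanishes_at F P.
Proof.
move=> Pp hF F0 v; rewrite Pp => /vlineP[c ->].
by rewrite -/(ev (c *: p) F) (ev_scale _ _ hF) F0 mulr0.
Qed.

Lemma ev_pt_ideal P p F : val P = <[p]>%VS -> pt_ideal P F -> ev p F = 0.
Proof.
move=> Pp [n [a [g [vg ->]]]]; rewrite ev_sum big1 // => i _.
have [_ /(_ p)] := vg i; rewrite Pp memv_line evM => /(_ isT).
by rewrite -/(ev p (g i)) => ->; rewrite mulr0.
Qed.

(** A form vanishing at one representative of a point vanishes on the whole line
    of k^3, hence is itself one of the generators of the ideal. *)
Lemma pt_ideal_homog P p F d : val P = <[p]>%VS -> F \is d.-homog ->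
  pt_ideal P F <-> ev p F = 0.
Proof.
move=> Pp hF; split; first exact: ev_pt_ideal.
move=> F0; exists 1%N, (fun=> 1), (fun=> F); split=> [_|]; last first.
  by rewrite big_ord1 mul1r.
by split; [exists d | apply: vanishes_at_ev hF F0].
Qed.

Lemma ideal_sqr_jet P p F : val P = <[p]>%VS -> ideal_sqr (pt_ideal P) F ->
  ev p F = 0 /\ grad p F = 0.
Proof.
move=> Pp [n [a [g [vg ->]]]]; split.
  rewrite ev_sum big1 // => i _; have [u [v [Iu Iv ->]]] := vg i.
  by rewrite !evM (ev_pt_ideal Pp Iu) mul0r mulr0.
rewrite grad_sum big1 // => i _; have [u [v [Iu Iv ->]]] := vg i.
rewrite !gradM evM (ev_pt_ideal Pp Iu) (ev_pt_ideal Pp Iv).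
by rewrite !(mul0r, scale0r, addr0, scaler0).
Qed.

Lemma ideal_sqrM P F G : pt_ideal P F -> pt_ideal P G ->
  ideal_sqr (pt_ideal P) (F * G).
Proof.
move=> IF IG; exists 1%N, (fun=> 1), (fun=> F * G); split=> [_|].
  by exists F, G.
by rewrite big_ord1 mul1r.
Qed.

(** First-order Taylor expansion at p in homogeneous form: with l = lin w of
    value 1 at p, each variable is p_i l plus a linear form vanishing at p, and
    a product of two linear forms of the latter kind lies in the square of the
    ideal. *)
Lemma one_jet_mod_sqr P p w F d : val P = <[p]>%VS -> dot w p = 1 ->
  F \is d.+1.-homog ->
  exists c u, dot u p = 0 /\
    ideal_sqr (pt_ideal P) (F - (c *: lin w + lin u) * lin w ^+ d).
Proof.
move=> Pp wp; set l := lin w; have [I0 IL] := ideal_gen_is_ideal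
  (fun f => exists g h, [/\ pt_ideal P g, pt_ideal P h & f = g * h]).
rewrite -/(ideal_sqr (pt_ideal P)) in I0 IL *.
have Ilin u : dot u p = 0 -> pt_ideal P (lin u).
  by move=> up; apply/(pt_ideal_homog Pp (lin_homog u)); rewrite ev_lin.
have var (i : 'I_3) : exists c u, dot u p = 0 /\ 'X_i = c *: l + lin u :> {mpoly k[3]}.
  exists (p 0 i), (- p 0 i *: w + delta_mx 0 i); split.
    by rewrite dotDl dotZl wp dotC dot_delta mulr1 addNr.
  rewrite lin_is_linear scaleNr addrA subrr add0r /lin (bigD1 i) //= big1 ?mxE ?eqxx.
    by rewrite scale1r addr0.
  by move=> j ji; rewrite mxE (negbTE ji) scale0r.
have mon e (m : 'X_{1..3}) : mdeg m = e.+1 -> exists c u, dot u p = 0 /\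
    ideal_sqr (pt_ideal P) ('X_[m] - (c *: l + lin u) * l ^+ e).
  elim: e m => [|e IH] m me.
    have /mdeg1P[i /eqP ->] : mdeg m == 1%N by rewrite me.
    have [c [u [up ->]]] := var i; exists c, u; split=> //.
    by rewrite expr0 mulr1 subrr.
  have [i mi] : exists i, (0 < m i)%N.
    apply: contrapT => /forallNP m0; suff: mdeg m = 0%N by rewrite me.
    by rewrite mdegE big1 // => i _; apply/eqP; rewrite -leqn0 leqNgt; apply/negP.
  have mE : m = (m - U_(i) + U_(i))%MM by rewrite submK // lep1mP -lt0n.
  have [|c [u [up Iu]]] := IH (m - U_(i))%MM.
    by have := me; rewrite {1}mE mdegD mdeg1 addn1 => -[].
  have [c' [u' [up' Xi]]] := var i.
  exists (c * c'), (c *: u' + (c' *: u + 0)); split.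
    by rewrite dotDl addr0 !dotZl up up' !mulr0 addr0.
  rewrite [in X in ideal_sqr _ X]mE mpolyXD !lin_is_linear.
  have -> : 'X_[m - U_(i)] * 'X_i - ((c * c') *: l + (c *: lin u' + (c' *: lin u + lin 0))) * l ^+ e.+1
    = 'X_i * ('X_[m - U_(i)] - (c *: l + lin u) * l ^+ e) + (l ^+ e * (lin u * lin u') + 0).
    rewrite lin0 Xi -!mul_mpolyC mpolyCM exprS; ring.
  by apply: (IL) => //; apply: (IL) => //; apply: ideal_sqrM; apply: Ilin.
move=> hF; rewrite (mpolyE F).
have: forall m, m \in msupp F -> mdeg m = d.+1 by move=> m /(dhomog_mf hF).
elim: (msupp F) => [_|m s IH ms].
  exists 0, 0; rewrite dot0l; split=> //; rewrite big_nil.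
  by rewrite lin0 scale0r addr0 mul0r subr0.
have [|c [u [up Iu]]] := mon d m; first by rewrite ms ?mem_head.
have [|c' [u' [up' Iu']]] := IH; first by move=> m' m's; rewrite ms // inE m's orbT.
exists (F@_m * c + c'), (F@_m *: u + u'); split.
  by rewrite dotDl dotZl up up' mulr0 addr0.
rewrite big_cons lin_is_linear; set x := \sum_(_ <- s) _ in Iu' *.
have -> : F@_m *: 'X_[m] + x - ((F@_m * c + c') *: l + (F@_m *: lin u + lin u')) * l ^+ d
  = (F@_m)%:MP * ('X_[m] - (c *: l + lin u) * l ^+ d) + (x - (c' *: l + lin u') * l ^+ d).
  rewrite -!mul_mpolyC mpolyCD mpolyCM; ring.
exact: IL.
Qed.

(** In the expansion of one_jet_mod_sqr, c is the value at p, and once c = 0 the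
    gradient at p is u. *)
Lemma ideal_sqr_homog P p F d : val P = <[p]>%VS -> F \is d.+1.-homog ->
  ideal_sqr (pt_ideal P) F <-> ev p F = 0 /\ grad p F = 0.
Proof.
move=> Pp hF; split; first exact: ideal_sqr_jet.
move=> [F0 gF0]; have p0 : p != 0.
  by apply/eqP => p0; have := valP P; rewrite /= Pp p0 dim_vline eqxx.
have [w0 pw0] := exists_dot_neq0 p0.
pose w := (dot p w0)^-1 *: w0.
have wp : dot w p = 1 by rewrite dotZl (dotC w0 p) mulVf.
have [c [u [up IF]]] := one_jet_mod_sqr Pp wp hF.
have [] := ideal_sqr_jet Pp IF.
rewrite evB gradB F0 gF0 !sub0r evM evD evZ evXn !ev_lin wp up expr1n addr0 !mulr1.
move=> /eqP; rewrite oppr_eq0 => /eqP c0; rewrite c0 scale0r add0r in IF *.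
rewrite gradM evXn !ev_lin wp up scale0r add0r expr1n scale1r grad_lin.
move/eqP; rewrite oppr_eq0 => /eqP u0; move: IF; rewrite u0.
by rewrite lin0 mul0r subr0.
Qed.

End PointIdeals.

(** * Jet relations at eleven points *)

Lemma dim_dhomog3 (k : fieldType) t : \dim {:dhomog 3 k t} = 'C(t + 2, 2).
Proof. by rewrite dimvf /dim /= -bin_sub ?leq_addr // addKn. Qed.

Lemma dim_lt_rV (k : fieldType) n (A : {vspace 'rV[k]_n}) v :
  v \notin A -> (\dim A < n)%N.
Proof.
move=> vA; rewrite -[X in (_ < X)%N](dim_rV k n) ltn_neqAle dimvS ?subvf // andbT.
apply: contra vA => dA; have /eqP -> : A == fullv by rewrite eqEdim subvf (eqP dA) /=.
exact: memvf.
Qed.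

Section Points.
Variables (k : fieldType) (T : finType) (p : T -> 'rV[k]_3).
Hypothesis char0 : [pchar k] =i pred0.
Implicit Types (a : {ffun T -> 'rV[k]_3}) (F G S : {mpoly k[3]}).

Lemma form_through (A : {set T}) t : (#|A| < 'C(t + 2, 2))%N ->
  exists2 F, F != 0 & F \is t.-homog /\ forall j, j \in A -> ev (p j) F = 0.
Proof.
move=> ltA; have [|//|F nF F0] := @kernel_nonzero k (dhomog 3 k t) 'rV[k]_#|A|
  (fun F : dhomog 3 k t => \row_l ev (p (enum_val l)) (mpoly_of_dhomog F)).
- by move=> c F G; apply/rowP => l; rewrite !mxE linearP evD evZ.
- by rewrite dim_rV dim_dhomog3.
exists (mpoly_of_dhomog F) => //; split=> [|j jA]; first exact: dhomog_is_dhomog.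
by move/rowP/(_ (enum_rank_in jA j)): F0; rewrite !mxE enum_rankK_in.
Qed.

(** The linear relations between the gradients at the points p_i of the forms of
    degree t. *)
Definition jet_relation t a :=
  forall F, F \is t.-homog -> \sum_i dot (a i) (grad (p i) F) = 0.

(** The instance of rank_relations for the map from forms to their gradients at
    the points. *)
Lemma double_forms_bound t r (K : {vspace dhomog 3 k t}) :
  (forall U : {vspace {ffun T -> 'rV[k]_3}},
     (forall a, a \in U -> jet_relation t a) -> (\dim U <= r)%N) ->
  (forall F : dhomog 3 k t, F \in K -> forall i, grad (p i) (mpoly_of_dhomog F) = 0) ->
  (#|T| * 3 + \dim K <= 'C(t + 2, 2) + r)%N.
Proof.
move=> relU K0.
have := @rank_relations k (dhomog 3 k t) {ffun T -> 'rV[k]_3}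
  (fun F : dhomog 3 k t => [ffun i => grad (p i) (mpoly_of_dhomog F)])
  (fun a b => \sum_i dot (a i) (b i)) K r.
rewrite dim_ffun dim_rV dim_dhomog3; apply.
- by move=> c F G; apply/ffunP => i; rewrite !ffunE linearP gradD gradZ.
- move=> b c a a'; rewrite mulr_sumr -big_split; apply: eq_bigr => i _.
  by rewrite !ffunE dotDl dotZl.
- move=> b c a a'; rewrite mulr_sumr -big_split; apply: eq_bigr => i _.
  by rewrite !ffunE dotDr dotZr.
- by move=> F /K0 F0; apply/ffunP => i; rewrite !ffunE F0.
move=> U Urel; apply: relU => a aU F hF; rewrite -[RHS](Urel a aU (DHomog hF)).
by apply: eq_bigr => i _; rewrite ffunE.
Qed.

Lemma jet_relation_at t a i F : jet_relation t a -> F \is t.-homog ->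
  (forall j, j != i -> dot (a j) (grad (p j) F) = 0) -> dot (a i) (grad (p i) F) = 0.
Proof.
by move=> rel hF F0; rewrite -[RHS](rel F hF) (bigD1 i) //= big1 ?addr0.
Qed.

(** Testing a relation on the multiples of S by linear forms isolates a_i when S is
    double at the other points that carry the relation. *)
Lemma jet_relation_eq0 s a i S : jet_relation (s + 1) a -> S \is s.-homog ->
  ev (p i) S != 0 ->
  (forall j, j != i -> a j = 0 \/ ev (p j) S = 0 /\ grad (p j) S = 0) -> a i = 0.
Proof.
move=> rel hS S0 Sj; apply: (jet_faithful char0 hS S0) => m.
apply: (jet_relation_at rel); first exact: dhomog_mul (lin_homog _).
move=> j /Sj[->|[e0 g0]]; first by rewrite dot0l.
by rewrite gradM e0 g0 scale0r scaler0 addr0 dot0r.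
Qed.

Lemma double_mul (q : 'rV[k]_3) F G : ev q F = 0 -> ev q G = 0 ->
  ev q (F * G) = 0 /\ grad q (F * G) = 0.
Proof. by move=> F0 G0; rewrite evM gradM F0 G0 mul0r !scale0r addr0. Qed.

Lemma sqr_double q F : ev q F = 0 -> ev q (F ^+ 2) = 0 /\ grad q (F ^+ 2) = 0.
Proof. by move=> F0; apply: double_mul. Qed.

Lemma double_mulr (q : 'rV[k]_3) F G : ev q F = 0 /\ grad q F = 0 ->
  ev q (F * G) = 0 /\ grad q (F * G) = 0.
Proof. by move=> [e0 g0]; rewrite evM gradM e0 g0 mul0r scale0r scaler0 addr0. Qed.

Lemma double_mull (q : 'rV[k]_3) F G : ev q G = 0 /\ grad q G = 0 ->
  ev q (F * G) = 0 /\ grad q (F * G) = 0.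
Proof. by rewrite mulrC; apply: double_mulr. Qed.

Lemma ev_eq0_of_grad d (q : 'rV[k]_3) F : F \is d.+1.-homog ->
  grad q F = 0 -> ev q F = 0.
Proof.
move=> hF g0; have := Euler q hF; rewrite g0 dot0r => /esym/eqP.
by rewrite mulf_eq0 ((pcharf0P k).1 char0) => /eqP.
Qed.

Hypothesis card_T : #|T| = 11%N.
Hypothesis no_cubic : forall F, F \is 3.-homog -> (forall j, ev (p j) F = 0) -> F = 0.
Hypothesis quartic_separates : forall i, exists Q,
  [/\ Q \is 4.-homog, ev (p i) Q != 0 & forall j, j != i -> ev (p j) Q = 0].

Lemma point_neq0 i : p i != 0.
Proof.
apply/eqP => pi0; have [Q [hQ]] := quartic_separates i.
by rewrite pi0 -(scale0r 0) (ev_scale _ _ hQ) expr0n mul0r eqxx.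
Qed.

Lemma line_off i : exists w, dot w (p i) != 0.
Proof. by have [w] := exists_dot_neq0 (point_neq0 i); exists w; rewrite dotC. Qed.

(** Distinct points lie on different lines; that the p_i represent distinct points
    is a consequence of the separation by quartics. *)
Lemma line_separates l i : l != i -> exists w, dot w (p l) = 0 /\ dot w (p i) != 0.
Proof.
move=> li; apply: contrapT => nw; have [Q [hQ Qi Ql]] := quartic_separates i.
have [c pE] : exists c, p i = c *: p l.
  apply: proportional_of_perp => w wl; apply: contrapT => /eqP wi.
  by apply: nw; exists w.
by move: Qi; rewrite pE (ev_scale _ _ hQ) Ql // mulr0 eqxx.
Qed.

Lemma lines_separate i : exists N : T -> 'rV[k]_3,
  forall l, l != i -> dot (N l) (p l) = 0 /\ dot (N l) (p i) != 0.
Proof.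
have /choice[N NE] : forall l, exists u, l != i -> dot u (p l) = 0 /\ dot u (p i) != 0.
  by move=> l; have [->|/line_separates[u]] := eqVneq l i; [exists 0 | exists u].
by exists N.
Qed.

Lemma form_separates t i : (4 <= t)%N -> exists Q,
  [/\ Q \is t.-homog, ev (p i) Q != 0 & forall j, j != i -> ev (p j) Q = 0].
Proof.
move=> t4; have [Q [hQ Qi Qj]] := quartic_separates i; have [w wi] := line_off i.
exists (Q * lin w ^+ (t - 4)); split.
- by have := dhomog_mul hQ (lin_exp_homog w (t - 4)); rewrite subnKC.
- by rewrite evM evXn ev_lin mulf_neq0 // expf_neq0.
by move=> j ji; rewrite evM Qj ?mul0r.
Qed.

(** Square the quartic that separates p_i from the other points. *)
Lemma regular_degree9 t a : (9 <= t)%N -> jet_relation t a -> forall i, a i = 0.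
Proof.
move=> t9 rel i; have [Q [hQ Qi Qj]] := quartic_separates i.
have [w wi] := line_off i.
apply: (@jet_relation_eq0 (t - 1) a i (Q ^+ 2 * lin w ^+ (t - 9))).
- by rewrite subnK //; lia.
- have -> : (t - 1 = 4 * 2 + (t - 9))%N by lia.
  by apply: dhomog_mul; [apply: dhomogMn | apply: lin_exp_homog].
- by rewrite evM !evXn ev_lin mulf_neq0 ?expf_neq0.
by move=> j ji; right; apply/double_mulr/sqr_double/Qj.
Qed.

(** By Euler's formula a relation with radial entries c_i p_i is a relation between
    the values of forms of degree t at the points, and these are independent. *)
Lemma radial_relation t a : (4 <= t)%N -> jet_relation t a ->
  (forall i, exists c, a i = c *: p i) -> forall i, a i = 0.
Proof.
move=> t4 rel rad i; have [Q [hQ Qi Qj]] := form_separates i t4.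
have := jet_relation_at (i := i) rel hQ.
have [c ->] := rad i; rewrite dotZl (Euler _ hQ) => H.
have /eqP : c * (t%:R * ev (p i) Q) = 0.
  apply: H => j ji; have [c' ->] := rad j.
  by rewrite dotZl (Euler _ hQ) Qj // !mulr0.
rewrite !mulf_eq0 ((pcharf0P k).1 char0) (negbTE Qi) orbF.
by rewrite (gtn_eqF (ltn_trans _ t4)) // orbF => /eqP ->; rewrite scale0r.
Qed.

Lemma dim_relations_at (U : {vspace {ffun T -> 'rV[k]_3}}) i :
  (forall a, a \in U -> a i = 0 -> a = 0) ->
  exists2 A : {vspace 'rV[k]_3}, (\dim U <= \dim A)%N
    & forall v, v \in A -> exists2 a, a \in U & v = a i.
Proof.
move=> inj; pose g (a : {ffun T -> 'rV[k]_3}) := a i.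
have lg : linear g by move=> c a a'; rewrite /g !ffunE.
pose gL : {linear {ffun T -> 'rV[k]_3} -> 'rV[k]_3} :=
  HB.pack g (GRing.isLinear.Build k _ _ _ g lg).
exists (linfun gL @: U)%VS.
  by apply: (dim_le_injective lg) => // a aU; rewrite -[g a](lfunE gL) memv_img.
by move=> v /memv_imgP[a aU ->]; exists a => //; rewrite lfunE.
Qed.

(** Such a line and conic would form a cubic through all the points. *)
Lemma no_line_conic_cover F : F \is 2.-homog -> F != 0 -> forall m, m != 0 ->
  ~ (forall j, dot m (p j) = 0 \/ ev (p j) F = 0).
Proof.
move=> hF nF m nm mF; have lm : lin m != 0 by rewrite lin_eq0.
have : lin m * F = 0.
  apply: no_cubic; first exact: dhomog_mul (lin_homog m) hF.
  by move=> j; rewrite evM ev_lin; case: (mF j) => ->; rewrite ?mul0r ?mulr0.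
by move/eqP; rewrite mulf_eq0 (negbTE lm) (negbTE nF).
Qed.

(** Otherwise every point would be separated from the ten others by a cubic, and
    the eleven values would be independent on the ten-dimensional space of
    cubics. *)
Lemma cubic_independent_subset : exists i0, forall F, F \is 3.-homog ->
  (forall j, j != i0 -> ev (p j) F = 0) -> F = 0.
Proof.
apply: contrapT => /forallNP no.
have sep i : exists F, [/\ F \is 3.-homog, ev (p i) F != 0
    & forall j, j != i -> ev (p j) F = 0].
  have /existsNP[F /not_implyP[hF /not_implyP[F0 nF]]] := no i.
  exists F; split=> //; apply/negP => /eqP Fi; apply/nF/no_cubic => // j.
  by have [->//|/F0] := eqVneq j i.
have := @independent_functionals k (dhomog 3 k 3) T
  (fun i (F : dhomog 3 k 3) => ev (p i) (mpoly_of_dhomog F)) 0%VS.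
rewrite card_T dim_dhomog3 dimv0 => indep; suff : (11 + 0 <= 'C(3 + 2, 2))%N by [].
apply: indep => [i c F G|F|c rel i].
- by rewrite linearP evD evZ.
- by rewrite memv0 => /eqP -> i; rewrite linear0 /ev meval0.
have [F [hF Fi Fj]] := sep i.
have := rel (DHomog hF); rewrite (bigD1 i) //= big1 => [|j ji].
  by rewrite addr0 => /eqP; rewrite mulf_eq0 (negbTE Fi) orbF => /eqP.
by rewrite Fj ?mulr0.
Qed.

(** Nine points lie on a cubic, and it cannot pass through the tenth one. *)
Lemma cubic_separators i : (forall F, F \is 3.-homog ->
    (forall j, j != i -> ev (p j) F = 0) -> F = 0) ->
  forall j, j != i -> exists S, [/\ S \is 3.-homog, ev (p j) S != 0
    & forall l, l != i -> l != j -> ev (p l) S = 0].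
Proof.
move=> no j ji; have [|S nS [hS S0]] := @form_through (~: [set i; j]) 3.
  by rewrite cardsCs setCK cards2 card_T eq_sym ji.
exists S; split=> // [|l li lj]; last by apply: S0; rewrite !inE negb_or li lj.
apply/negP => /eqP Sj; case/eqP: nS; apply: no => // l li.
by have [->//|lj] := eqVneq l j; apply: S0; rewrite !inE negb_or li lj.
Qed.

(** When G passes through all the points, the gradient of S G at p_j is
    S(p_j) times that of G. *)
Lemma jet_relation_through s d a i S G : jet_relation (s + d) a ->
  S \is s.-homog -> G \is d.-homog -> (forall j, ev (p j) G = 0) ->
  ev (p i) S != 0 ->
  (forall j, j != i -> ev (p j) S = 0 \/ dot (a j) (grad (p j) G) = 0) ->
  dot (a i) (grad (p i) G) = 0.
Proof.
move=> rel hS hG G0 Si Sj.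
have : dot (a i) (grad (p i) (S * G)) = 0.
  apply: (jet_relation_at rel) => [|j ji]; first exact: dhomog_mul.
  by rewrite gradM G0 scale0r addr0 dotZr; case: (Sj j ji) => ->; rewrite ?mul0r ?mulr0.
rewrite gradM G0 scale0r addr0 dotZr => /eqP.
by rewrite mulf_eq0 (negbTE Si) => /eqP.
Qed.

(** * No five points on a line *)

Section NoFiveCollinear.
Hypothesis few_on_line : forall m, m != 0 -> (#|[set j | dot m (p j) == 0%R]| <= 4)%N.

(** If v is not radial, the eleven values and the derivative along v at p_i are
    independent on quartics, so they have a common kernel of dimension 3 at
    most. If all quartics through the points were tangent to v, this kernel
    would be the space of quartics through the eleven points, of dimension at
    least 15 - 11. *)
Lemma quartic_gradients_independent i v :
  (forall F, F \is 3.-homog -> (forall j, j != i -> ev (p j) F = 0) -> F = 0) ->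
  (forall G, G \is 4.-homog -> (forall j, ev (p j) G = 0) ->
    dot v (grad (p i) G) = 0) ->
  exists c, v = c *: p i.
Proof.
move=> no tangent; apply: contrapT => nv.
have [|K KE] := @kernel_exists k (dhomog 3 k 4) {ffun T -> k^o}
  (fun F : dhomog 3 k 4 => [ffun j => ev (p j) (mpoly_of_dhomog F)]).
  by move=> c F G; apply/ffunP => j; rewrite !ffunE linearP evD evZ.
rewrite dim_ffun_scalar card_T dim_dhomog3 => dK.
have K0 (F : dhomog 3 k 4) : F \in K -> forall j, ev (p j) (mpoly_of_dhomog F) = 0.
  by move=> /KE/ffunP F0 j; have := F0 j; rewrite !ffunE.
have := @independent_functionals k (dhomog 3 k 4) (option T)
  (fun o (F : dhomog 3 k 4) => if o is Some j then ev (p j) (mpoly_of_dhomog F)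
              else dot v (grad (p i) (mpoly_of_dhomog F))) K.
rewrite card_option card_T dim_dhomog3 => indep.
suff : (12 + \dim K <= 'C(4 + 2, 2))%N by move: dK; rewrite (_ : 'C(6, 2) = 15)%N //; lia.
apply: indep => [[j|] c F G|F FK [j|]|c rel].
- by rewrite linearP evD evZ.
- by rewrite linearP gradD gradZ dotDr dotZr.
- exact: K0.
- by apply: tangent; [apply: dhomog_is_dhomog | apply: K0].
(* By Euler's formula the value at p_i is the derivative along p_i / 4, so it can
   be merged with the derivative along v into a single vector v'. *)
pose v' := c None *: v + (c (Some i) / 4%:R) *: p i.
have n4 : 4%:R != 0 :> k by rewrite ((pcharf0P k).1 char0).
have rel' G : G \is 4.-homog ->
    \sum_(j | j != i) c (Some j) * ev (p j) G + dot v' (grad (p i) G) = 0.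
  move=> hG; rewrite dotDl !dotZl (Euler _ hG) mulrA divfK //.
  have R0 := rel (DHomog hG); rewrite big_option /= (bigD1 i) //= in R0.
  rewrite -[RHS]R0; ring.
(* The line M through p_i in the direction v: the tests M S, with S a cubic
   separating p_j from the other points except p_i, kill the coefficients off M. *)
have [M nM [Mp Mv]] : exists2 M, M != 0 & dot M (p i) = 0 /\ dot M v = 0.
  have [||M nM M0] := @kernel_nonzero k 'rV[k]_3 'rV[k]_2
    (fun M => \row_l dot M (if l == 0 then p i else v)).
  - by move=> b u u'; apply/rowP => l; rewrite !mxE dotDl dotZl.
  - by rewrite !dim_rV.
  exists M => //; split.
    by move/rowP/(_ 0): M0; rewrite !mxE.
  by move/rowP/(_ 1): M0; rewrite !mxE.
have Mv' : dot v' M = 0 by rewrite dotDl !dotZl !(dotC _ M) Mp Mv !mulr0 addr0.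
have off j : j != i -> dot M (p j) != 0 -> c (Some j) = 0.
  move=> ji Mj; have [S [hS Sj Sl]] := cubic_separators no ji.
  have := rel' _ (dhomog_mul (lin_homog M) hS).
  rewrite (bigD1 j) //= big1 => [|l /andP[li lj]]; last by rewrite evM Sl // !mulr0.
  rewrite gradM ev_lin Mp scale0r add0r grad_lin dotZr Mv' mulr0 !addr0 evM ev_lin.
  by move/eqP; rewrite !mulf_eq0 (negbTE Mj) (negbTE Sj) !orbF => /eqP.
(* At most three other points are on M, so lines through them and one more
   arbitrary line form quartics that test all jets at p_i. *)
pose D := [set j | (dot M (p j) == 0) && (j != i)].
have cD : (#|D| <= 3)%N.
  have := few_on_line nM; rewrite (cardsD1 i) inE Mp eqxx add1n ltnS.
  by congr (_ <= _)%N; apply: eq_card => j; rewrite !inE andbC.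
have v'0 : v' = 0.
  have [w wi] := line_off i.
  have [N NE] := lines_separate i.
  pose S := (\prod_(j in D) lin (N j)) * lin w ^+ (3 - #|D|).
  have hS : S \is 3.-homog.
    apply: (dhomog_cast (subnKC cD)); apply: dhomog_mul (lin_exp_homog _ _).
    by apply: (dhomog_cast (muln1 _)); apply: dhomog_prod_const => j _; apply: lin_homog.
  apply: (jet_faithful char0 hS (p := p i)) => [|m].
    rewrite evM evXn ev_lin ev_prod mulf_neq0 ?expf_neq0 //.
    apply/prodf_neq0 => j; rewrite inE => /andP[_ ji].
    by rewrite ev_lin; have [] := NE j ji.
  have := rel' _ (dhomog_mul hS (lin_homog m)); rewrite big1 ?add0r // => j ji.
  have [Mj|Mj] := eqVneq (dot M (p j)) 0; last by rewrite off ?mul0r.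
  rewrite evM /S evM ev_prod (bigD1 j) ?inE ?Mj ?eqxx //= ev_lin (NE j ji).1.
  by rewrite !mul0r mulr0.
have cN : c None = 0.
  apply: contrapT => /eqP cN; apply: nv.
  exists (- (c None)^-1 * (c (Some i) / 4%:R)).
  have -> : v = (c None)^-1 *: (v' - (c (Some i) / 4%:R) *: p i).
    by rewrite addrK scalerA mulVf ?scale1r.
  by rewrite v'0 sub0r scalerN scalerA -scaleNr mulNr.
move=> [j|//]; have [Q [hQ Qj Ql]] := quartic_separates j.
have := rel (DHomog hQ); rewrite big_option /= cN mul0r add0r (bigD1 j) //= big1.
  by rewrite addr0 => /eqP; rewrite mulf_eq0 (negbTE Qj) orbF => /eqP.
by move=> l lj; rewrite Ql // mulr0.
Qed.

(** If a cubic F passes through the other points and not through p_i, the quartics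
    F N, with N a line through p_i, already have gradients in all non-radial
    directions. Otherwise the ten other points lie on no cubic. *)
Lemma quartic_gradients i v :
  (forall G, G \is 4.-homog -> (forall j, ev (p j) G = 0) ->
    dot v (grad (p i) G) = 0) ->
  exists c, v = c *: p i.
Proof.
move=> tangent; have [no|/existsNP[F /not_implyP[hF /not_implyP[F0 nF]]]] :=
  pselect (forall F, F \is 3.-homog -> (forall j, j != i -> ev (p j) F = 0) -> F = 0).
  exact: quartic_gradients_independent.
have Fi : ev (p i) F != 0.
  apply/negP => /eqP Fi; apply/nF/no_cubic => // j.
  by have [->//|/F0] := eqVneq j i.
apply: proportional_of_perp => w wi.
have : dot v (grad (p i) (F * lin w)) = 0.
  apply: tangent => [|j]; first exact: dhomog_mul hF (lin_homog w).
  rewrite evM ev_lin; have [->|/F0 ->] := eqVneq j i; last by rewrite mul0r.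
  by rewrite wi mulr0.
rewrite gradM ev_lin wi scale0r addr0 grad_lin dotZr => /eqP.
by rewrite mulf_eq0 (negbTE Fi) dotC => /eqP.
Qed.

Lemma no_relation8 a : jet_relation 8 a -> forall i, a i = 0.
Proof.
move=> rel; apply: (radial_relation _ rel) => // i; apply: quartic_gradients => G hG G0.
have [Q [hQ Qi Qj]] := quartic_separates i.
apply: (jet_relation_through (s := 4) (d := 4) rel hQ hG G0 Qi) => j ji.
by left; apply: Qj.
Qed.

(** Take i0 such that the ten other points p_j lie on no cubic, hence are separated
    by cubics S_j. If a_i0 is radial, testing on S_j G, with G a quartic through
    the points, shows that every a_j is radial, so the relation is 0. Thus the
    values a_i0 form a space isomorphic to U that does not contain p_i0. *)
Lemma relations7 (U : {vspace {ffun T -> 'rV[k]_3}}) :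
  (forall a, a \in U -> jet_relation 7 a) -> (\dim U <= 2)%N.
Proof.
move=> Urel; have [i0 no] := cubic_independent_subset.
have key a c : a \in U -> a i0 = c *: p i0 -> a = 0.
  move=> /Urel rel ai0; apply/ffunP => j; rewrite ffunE.
  apply: (radial_relation _ rel) => // {}j.
  have [->|ji0] := eqVneq j i0; first by exists c.
  apply: quartic_gradients => G hG G0.
  have [S [hS Sj Sl]] := cubic_separators no ji0.
  apply: (jet_relation_through (s := 3) (d := 4) rel hS hG G0 Sj) => l lj.
  have [->|li0] := eqVneq l i0; last by left; apply: Sl.
  by right; rewrite ai0 dotZl (Euler _ hG) G0 !mulr0.
have [a aU ai0|A leA AE] := @dim_relations_at U i0.
  by apply: (key a 0) => //; rewrite scale0r.
apply: leq_trans leA _; rewrite -ltnS; apply: (@dim_lt_rV _ _ _ (p i0)).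
apply/negP => /AE[a aU pE]; have a0 : a = 0 by apply: (key a 1); rewrite ?scale1r.
by have := point_neq0 i0; rewrite pE a0 ffunE eqxx.
Qed.
End NoFiveCollinear.

(** * Five points on a line *)

Section FiveCollinear.
Variable m0 : 'rV[k]_3.
Hypothesis m0_neq0 : m0 != 0.
Let L := [set j | dot m0 (p j) == 0].
Hypothesis five_on_line : (5 <= #|L|)%N.

(** If six points were on the line, the remaining ones, five at most, would lie on
    a conic. *)
Lemma card_collinear : #|L| = 5%N.
Proof.
apply/eqP; rewrite eqn_leq five_on_line andbT leqNgt; apply/negP => L6.
have [|F nF [hF F0]] := @form_through (~: L) 2.
  by rewrite cardsCs setCK card_T (_ : 'C(2 + 2, 2) = 6)%N //; lia.
apply: (no_line_conic_cover hF nF m0_neq0) => j.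
have [jL|jL] := boolP (j \in L); first by left; move: jL; rewrite inE => /eqP.
by right; apply: F0; rewrite inE.
Qed.

(** A conic through the five other points off L misses p_i, as otherwise it would
    cover X together with L. *)
Lemma conic_separates i : i \notin L -> exists F,
  [/\ F \is 2.-homog, ev (p i) F != 0 & forall j, j \notin L -> j != i -> ev (p j) F = 0].
Proof.
move=> iL; have [|F nF [hF F0]] := @form_through (~: (i |: L)) 2.
  by rewrite cardsCs setCK cardsU1 iL card_collinear card_T.
exists F; split=> // [|j jL ji]; last by apply: F0; rewrite !inE negb_or ji; rewrite inE in jL.
apply/negP => /eqP Fi; apply: (no_line_conic_cover hF nF m0_neq0) => j.
have [jL|jL] := boolP (j \in L); first by left; move: jL; rewrite inE => /eqP.
right; have [->//|ji] := eqVneq j i.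
by apply: F0; rewrite inE in_setU1 negb_or ji.
Qed.

(** With F the conic separating p_i from the other points off L, the form
    L^2 F^2 is double at all points except p_i. *)
Lemma relation_off_line t a i : (7 <= t)%N -> jet_relation t a -> i \notin L -> a i = 0.
Proof.
move=> t7 rel iL; have [F [hF Fi Fj]] := conic_separates iL.
have mi : dot m0 (p i) != 0 by move: iL; rewrite inE.
apply: (@jet_relation_eq0 (t - 1) a i (lin m0 ^+ 2 * F ^+ 2 * lin m0 ^+ (t - 7))).
- by rewrite subnK //; lia.
- apply: (dhomog_cast (_ : (2 + 2 * 2 + (t - 7) = t - 1)%N)); first by lia.
  by do 2?apply: dhomog_mul; rewrite ?lin_exp_homog ?dhomogMn.
- by rewrite !evM !evXn ev_lin !mulf_neq0 ?expf_neq0.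
move=> j ji; right; apply: double_mulr.
have [jL|jL] := boolP (j \in L).
  by apply/double_mulr/sqr_double; rewrite ev_lin; move: jL; rewrite inE => /eqP.
exact/double_mull/sqr_double/Fj.
Qed.

(** Test on L Q, whose gradient at a point of L is a multiple of that of L, with Q
    separating p_i from the other points. *)
Lemma relation_tangent t a i : (7 <= t)%N -> jet_relation t a -> i \in L ->
  dot (a i) m0 = 0.
Proof.
move=> t7 rel iL; have [|Q [hQ Qi Qj]] := @form_separates (t - 1) i; first by lia.
have m0L j : j \in L -> dot m0 (p j) = 0 by rewrite inE => /eqP.
have : dot (a i) (grad (p i) (lin m0 * Q)) = 0.
  apply: (jet_relation_at rel) => [|j ji].
    apply: (dhomog_cast (_ : (1 + (t - 1) = t)%N)); first by lia.
    exact: dhomog_mul (lin_homog m0) hQ.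
  have [/m0L mj|jL] := boolP (j \in L); last by rewrite (relation_off_line t7 rel jL) dot0l.
  by rewrite gradM ev_lin mj Qj // !scale0r addr0 dot0r.
rewrite gradM ev_lin m0L // scale0r add0r grad_lin dotZr => /eqP.
by rewrite mulf_eq0 (negbTE Qi) => /eqP.
Qed.

(** For j on L other than i, let N_l be lines through the three remaining points
    of L that miss p_j; the product of their squares is double at these three
    points, and the relation vanishes at the points off L and at p_i. *)
Lemma relation_determined t a i : (7 <= t)%N -> jet_relation t a -> i \in L ->
  a i = 0 -> a = 0.
Proof.
move=> t7 rel iL ai0; apply/ffunP => j; rewrite ffunE.
have [->//|ji] := eqVneq j i.
have [jL|jL] := boolP (j \in L); last exact: relation_off_line rel jL.
have [N NE] := lines_separate j.
have [w wj] := line_off j.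
pose D := L :\ i :\ j.
have cD : #|D| = 3%N.
  have := card_collinear; rewrite (cardsD1 i) iL (cardsD1 j) !inE ji.
  by move: jL; rewrite inE => ->; rewrite /D; lia.
apply: (@jet_relation_eq0 (t - 1) a j
  ((\prod_(l in D) lin (N l) ^+ 2) * lin w ^+ (t - 7))).
- by rewrite subnK //; lia.
- apply: (dhomog_cast (_ : (#|D| * 2 + (t - 7) = t - 1)%N)); first by rewrite cD; lia.
  apply: dhomog_mul (lin_exp_homog _ _); apply: dhomog_prod_const => l _.
  exact: lin_exp_homog.
- rewrite evM evXn ev_lin ev_prod mulf_neq0 ?expf_neq0 //; apply/prodf_neq0 => l.
  by rewrite !inE => /andP[lj _]; rewrite evXn ev_lin expf_neq0 //; have [] := NE l lj.
move=> l lj; have [lL|lL] := boolP (l \in L); last by left; apply: relation_off_line rel lL.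
have [->|li] := eqVneq l i; first by left.
right; apply: double_mulr.
have lD : l \in D by rewrite 2!in_setD1 lj li lL.
rewrite (bigD1 l) //=; apply/double_mulr/sqr_double.
by rewrite ev_lin; have [] := NE l lj.
Qed.

(** The values at p_i of the relations in U form a space isomorphic to U inside the
    plane of vectors tangent to L. In degree 8 this space is proper: the product
    of the squares of four lines through the other points of L is a form of
    degree exactly 8, and testing on it excludes the radial vector p_i. *)
Lemma collinear_relations t (U : {vspace {ffun T -> 'rV[k]_3}}) : (7 <= t)%N ->
  (forall a, a \in U -> jet_relation t a) ->
  (\dim U <= 2)%N /\ (t = 8 -> \dim U <= 1)%N.
Proof.
move=> t7 Urel; have [i iL] : exists i, i \in L.
  by apply/set0Pn; rewrite -card_gt0; apply: leq_trans five_on_line.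
have [a aU|A leA AE] := @dim_relations_at U i.
  exact: relation_determined (Urel a aU) iL.
have Am v : v \in A -> dot v m0 = 0.
  by move=> /AE[a aU ->]; apply: relation_tangent (Urel a aU) iL.
have [e me] := exists_dot_neq0 m0_neq0.
(* The vector e is not tangent to L. *)
have perp_dim (B : {vspace 'rV[k]_3}) : (forall v, v \in B -> dot v m0 = 0) -> (\dim B <= 2)%N.
  move=> Bm; rewrite -ltnS; apply: (@dim_lt_rV _ _ _ e).
  by apply: contra me => /Bm; rewrite dotC => ->.
split; first exact: leq_trans leA (perp_dim _ Am).
move=> t8; apply: leq_trans leA _; rewrite t8 in Urel.
have pA : p i \notin A.
  apply/negP => /AE[a aU pE].
  have [N NE] := lines_separate i.
  pose S := \prod_(l in L :\ i) lin (N l) ^+ 2.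
  have hS : S \is 8.-homog.
    apply: (dhomog_cast (_ : (#|L :\ i| * 2 = 8)%N)).
      by have := card_collinear; rewrite (cardsD1 i) iL; lia.
    by apply: dhomog_prod_const => l _; apply: lin_exp_homog.
  have Si : ev (p i) S != 0.
    rewrite ev_prod; apply/prodf_neq0 => l; rewrite !inE => /andP[li _].
    by rewrite evXn ev_lin expf_neq0 //; have [] := NE l li.
  have := jet_relation_at (i := i) (Urel a aU) hS.
  rewrite -pE (Euler _ hS) => S0; case/eqP: Si; apply: (mulfI (x := 8%:R)).
    by rewrite ((pcharf0P k).1 char0).
  rewrite mulr0; apply: S0 => l li.
  have [lL|lL] := boolP (l \in L); last first.
    by rewrite (relation_off_line _ (Urel a aU) lL) // dot0l.
  have [_ g0] : ev (p l) S = 0 /\ grad (p l) S = 0.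
    rewrite /S (bigD1 l) ?in_setD1 ?li //=; apply/double_mulr/sqr_double.
    by rewrite ev_lin; have [] := NE l li.
  by rewrite g0 dot0r.
(* A and p_i are independent and both tangent to L. *)
have : (\dim (A + <[p i]>) <= 2)%N.
  apply: perp_dim => v /memv_addP[u /Am u0 [w /vlineP[c ->] ->]].
  by move: iL; rewrite inE dotDl dotZl u0 add0r dotC => /eqP ->; rewrite mulr0.
rewrite dimv_disjoint_sum ?dim_vline ?point_neq0 ?addn1 //.
apply/eqP; rewrite -subv0; apply/subvP => v; rewrite memv_cap memv0 => /andP[vA /vlineP[c vE]].
have [c0|c0] := eqVneq c 0; first by rewrite vE c0 scale0r.
by case/negP: pA; rewrite -[p i](scalerK c0) -vE memvZ.
Qed.
End FiveCollinear.

(** * Forms double at eleven points *)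

Lemma five_collinear_or_few :
  (exists m, m != 0 /\ (5 <= #|[set j | dot m (p j) == 0%R]|)%N) \/
  (forall m, m != 0 -> (#|[set j | dot m (p j) == 0%R]| <= 4)%N).
Proof.
have [h|h] := pselect (exists m, m != 0 /\ (5 <= #|[set j | dot m (p j) == 0%R]|)%N).
  by left.
by right=> m nm; rewrite leqNgt; apply/negP => m5; apply: h; exists m.
Qed.

Lemma double_forms7 (K : {vspace dhomog 3 k 7}) :
  (forall F : dhomog 3 k 7, F \in K -> forall i, grad (p i) (mpoly_of_dhomog F) = 0) ->
  (\dim K <= 5)%N.
Proof.
move=> K0; suff : (#|T| * 3 + \dim K <= 'C(7 + 2, 2) + 2)%N.
  by rewrite card_T (_ : 'C(7 + 2, 2) = 36)%N //; lia.
apply: double_forms_bound K0 => U Urel.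
have [[m [nm m5]]|few] := five_collinear_or_few; last exact: relations7.
by have [] := collinear_relations nm m5 (isT : 7 <= 7)%N Urel.
Qed.

Lemma double_forms8 (K : {vspace dhomog 3 k 8}) :
  (forall F : dhomog 3 k 8, F \in K -> forall i, grad (p i) (mpoly_of_dhomog F) = 0) ->
  (\dim K <= 13)%N.
Proof.
move=> K0; suff : (#|T| * 3 + \dim K <= 'C(8 + 2, 2) + 1)%N.
  by rewrite card_T (_ : 'C(8 + 2, 2) = 45)%N //; lia.
apply: double_forms_bound K0 => U Urel.
have [[m [nm m5]]|few] := five_collinear_or_few.
  by have [_ /(_ erefl)] := collinear_relations nm m5 (isT : 7 <= 8)%N Urel.
suff /eqP -> : \dim U == 0%N by [].
rewrite dimv_eq0 -subv0; apply/subvP => a aU; rewrite memv0; apply/eqP/ffunP => i.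
by rewrite ffunE; apply: no_relation8 (Urel a aU) i.
Qed.

Lemma double_forms9 t (K : {vspace dhomog 3 k t}) : (9 <= t)%N ->
  (forall F : dhomog 3 k t, F \in K -> forall i, grad (p i) (mpoly_of_dhomog F) = 0) ->
  (33 + \dim K <= 'C(t + 2, 2))%N.
Proof.
move=> t9 K0; have -> : 33%N = (#|T| * 3)%N by rewrite card_T.
rewrite -['C(_, _)]addn0; apply: double_forms_bound K0 => U Urel.
rewrite leqn0 dimv_eq0 -subv0; apply/subvP => a aU; rewrite memv0; apply/eqP/ffunP => i.
by rewrite ffunE; apply: regular_degree9 (Urel a aU) i.
Qed.

End Points.

(** * Multiples of a space of forms by linear forms *)

Section LeadingMonomials.
Variable k : fieldType.
Local Notation mon := 'X_{1..3}.

Definition is_lead d (V : {vspace dhomog 3 k d}) (m : mon) :=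
  exists F, [/\ F \in V, F != 0 & mlead (mpoly_of_dhomog F) = m].

Lemma coeff_kernel d (V : {vspace dhomog 3 k d}) (s : seq mon) :
  exists2 K : {vspace dhomog 3 k d},
    (forall F, F \in K <-> F \in V /\ forall m, m \in s -> (mpoly_of_dhomog F)@_m = 0)
    & (\dim V <= \dim K + size s)%N.
Proof.
have [|K KE dK] := @kernel_exists k (dhomog 3 k d) 'rV[k]_(size s)
  (fun F : dhomog 3 k d => \row_l (mpoly_of_dhomog F)@_(nth 0%MM s l)).
  by move=> c F G; apply/rowP => l; rewrite !mxE !linearP.
exists (V :&: K)%VS => [F|].
  rewrite memv_cap; split=> [/andP[FV /KE F0]|[FV F0]].
    split=> // m ms; have lt : (index m s < size s)%N by rewrite index_mem.
    by move/rowP/(_ (Ordinal lt)): F0; rewrite !mxE /= nth_index.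
  rewrite FV; apply/KE/rowP => l; rewrite !mxE F0 //.
  exact: mem_nth.
have := dimv_sum_cap V K; have := dimvS (subvf (V + K)).
by rewrite dim_rV in dK; lia.
Qed.

(** Some nonzero form of V has vanishing coefficients on s, and its leading
    coefficient is not 0. *)
Lemma lead_outside d (V : {vspace dhomog 3 k d}) (s : seq mon) :
  (size s < \dim V)%N -> exists2 m, is_lead V m & m \notin s.
Proof.
move=> lt; have [K KE dK] := coeff_kernel V s.
have nK : vpick K != 0 by rewrite vpick0 -dimv_eq0; lia.
have /KE[FV F0] := memv_pick K.
exists (mlead (mpoly_of_dhomog (vpick K))); first by exists (vpick K).
apply/negP => /F0/eqP; rewrite mleadc_eq0 => /eqP F00; case/eqP: nK.
exact: val_inj.
Qed.

(** Forms with distinct leading monomials are independent: the coefficient of the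
    largest monomial vanishes on all the other forms. *)
Lemma size_leads_sorted d (V : {vspace dhomog 3 k d}) (s : seq mon) :
  sorted >%O s -> (forall m, m \in s -> is_lead V m) -> (size s <= \dim V)%N.
Proof.
elim: s V => [//|m s IH] V /= ps Vs.
have lt_m m' : m' \in s -> (m' < m)%O.
  by move: ps; rewrite (path_sortedE (fun _ _ _ h1 h2 => lt_trans h2 h1)) => /andP[/allP h _] /h.
have [K KE dK] := coeff_kernel V [:: m].
have [F [FV nF Fm]] := Vs m (mem_head _ _).
have FK : F \notin K.
  apply/negP => /KE[_ /(_ m (mem_head _ _))/eqP]; rewrite -Fm mleadc_eq0.
  by move/eqP => F0; case/eqP: nF; apply: val_inj.
have KV : (K <= V)%VS by apply/subvP => G /KE[].
have : (\dim K < \dim V)%N.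
  rewrite ltn_neqAle dimvS // andbT; apply: contra FK => dKV.
  by have /eqP -> : K == V by rewrite eqEdim KV (eqP dKV) /=.
apply: leq_trans; rewrite ltnS; apply: IH; first exact: path_sorted ps.
move=> m' m's; have [G [GV nG Gm]] := Vs m' (mem_behead (s := m :: s) m's).
exists G; split=> //; apply/KE; split=> // m''; rewrite inE => /eqP ->.
by apply: mcoeff_gt_mlead; rewrite Gm; apply: lt_m.
Qed.

Lemma size_leads d (V : {vspace dhomog 3 k d}) (s : seq mon) :
  uniq s -> (forall m, m \in s -> is_lead V m) -> (size s <= \dim V)%N.
Proof.
move=> us Vs; rewrite -(size_sort <=%O s) -size_rev; apply: size_leads_sorted => [|m].
  by rewrite rev_sorted sort_lt_sorted.
by rewrite mem_rev mem_sort; apply: Vs.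
Qed.

Definition shifts (m : mon) := [seq (m + U_(i))%MM | i <- enum 'I_3].

Lemma shift_inj (m : mon) : injective (fun i => m + U_(i))%MM.
Proof.
move=> i j /addmI/mnmP/(_ i); rewrite !mnm1E eqxx.
by case: eqVneq.
Qed.

(** If b + e_i = a + e_j with a != b, then b - a determines i and j. *)
Lemma shifts_overlap (a b : mon) : a != b ->
  (#|[pred i | (b + U_(i))%MM \in shifts a]| <= 1)%N.
Proof.
move=> ab; apply/card_le1_eqP => i i'; rewrite !inE => /mapP[j _ ej] /mapP[j' _ ej'].
have ij : i != j by apply: contra ab => /eqP ij; move: ej; rewrite ij => /addIm ->.
have ij' : i' != j' by apply: contra ab => /eqP ij'; move: ej'; rewrite ij' => /addIm ->.
apply/eqP; apply: contraT => ii'.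
move/mnmP/(_ i'): ej; move/mnmP/(_ i'): ej'; rewrite !mnmDE !mnm1E eqxx.
by rewrite (eq_sym j') (negbTE ij') (eq_sym i) (negbTE ii'); lia.
Qed.

(** The three sets of three shifts overlap pairwise in one element at most, and
    3 + 2 + 1 = 6. *)
Lemma six_shifts (a b c : mon) : uniq [:: a; b; c] -> exists s : seq mon,
  [/\ uniq s, (6 <= size s)%N
    & forall m, m \in s -> exists i m', m' \in [:: a; b; c] /\ m = (m' + U_(i))%MM].
Proof.
rewrite /= !inE !negb_or andbT => /andP[/andP[ab ac] bc].
pose Sb := [pred i : 'I_3 | (b + U_(i))%MM \notin shifts a].
pose Sc := [pred i : 'I_3 | ((c + U_(i))%MM \notin shifts a) && ((c + U_(i))%MM \notin shifts b)].
exists (shifts a ++ [seq (b + U_(i))%MM | i <- enum Sb] ++ [seq (c + U_(i))%MM | i <- enum Sc]).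
split.
- rewrite !cat_uniq !(map_inj_uniq (@shift_inj _)) !enum_uniq /= andbT.
  apply/andP; split.
    apply/hasPn => m; rewrite mem_cat => /orP[]/mapP[i]; rewrite mem_enum inE.
      by move=> h ->.
    by move=> /andP[h _] ->.
  apply/hasPn => m /mapP[i]; rewrite mem_enum inE => /andP[_ h] ->.
  by apply: contra h => /mapP[j _ ->]; apply: map_f; rewrite mem_enum.
- rewrite !size_cat (size_map _ (enum Sb)) (size_map _ (enum Sc)) -!cardE.
  have -> : size (shifts a) = 3%N by rewrite size_map size_enum_ord.
  have := shifts_overlap ab; have := shifts_overlap ac; have := shifts_overlap bc.
  set p1 := [pred i | _] => c1; set p2 := [pred i | _] => c2; set p3 := [pred i | _] => c3.
  have eb : (#|p3| + #|Sb| = 3)%N by rewrite -[RHS](card_ord 3) -(cardC p3).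
  have ec : (#|[predU p2 & p1]| + #|Sc| = 3)%N.
    rewrite -[RHS](card_ord 3) -(cardC [predU p2 & p1]); congr (_ + _)%N.
    by apply: eq_card => i; rewrite !inE negb_or.
  have eu := cardUI p2 p1; move: eb ec eu c1 c2 c3.
  move: #|p1| #|p2| #|p3| #|Sb| #|Sc| #|[predU p2 & p1]| #|[predI p2 & p1]|; lia.
move=> m; rewrite !mem_cat => /or3P[]/mapP[i _ ->].
- by exists i, a; rewrite mem_head.
- by exists i, b; rewrite !inE eqxx orbT.
by exists i, c; rewrite !inE eqxx !orbT.
Qed.

Lemma mpolyX_eq0 (m : mon) : ('X_[m] == 0 :> {mpoly k[3]}) = false.
Proof. by rewrite -msupp_eq0 msuppX. Qed.

(** The leading monomials of X_i F are the shifts of that of F, so three leading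
    monomials of V yield six of W. *)
Lemma dim_linear_multiples d (V : {vspace dhomog 3 k d}) e (W : {vspace dhomog 3 k e}) :
  (forall F i, F \in V ->
    exists2 G, G \in W & mpoly_of_dhomog G = 'X_i * mpoly_of_dhomog F) ->
  (3 <= \dim V)%N -> (6 <= \dim W)%N.
Proof.
move=> VW V3; have [|a Va _] := @lead_outside d V [::]; first by apply: leq_trans V3.
have [|b Vb ba] := @lead_outside d V [:: a]; first by apply: leq_trans V3.
have [|c Vc cab] := @lead_outside d V [:: a; b]; first by apply: leq_trans V3.
have [|s [us s6 sE]] := @six_shifts a b c.
  by move: ba cab; rewrite /= !inE !negb_or andbT (eq_sym b) (eq_sym c) (eq_sym c) => -> /andP[-> ->].
apply: leq_trans s6 _; apply: size_leads us _ => m /sE[i [m' [m'V ->]]].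
have {m'V} : is_lead V m' by move: m'V; rewrite !inE => /or3P[]/eqP ->.
move=> [F [/(VW _ i)[G GW GE] nF Fm]]; exists G; split=> //.
  apply: contra nF => /eqP G0; move/eqP: GE; rewrite G0 linear0 eq_sym mulf_eq0 => /orP[|F0].
    by rewrite mpolyX_eq0.
  by apply/eqP/val_inj/eqP.
have nF' : mpoly_of_dhomog F != 0 by apply: contra nF => F0; apply/eqP/val_inj/eqP.
rewrite GE mleadM ?mpolyX_eq0 // mleadXm Fm; exact: addmC.
Qed.
End LeadingMonomials.

(** * Graded pieces of the ideals of points and of double points *)

Section HilbertFunctions.
Variables (k : closedFieldType) (T : finType) (p : T -> 'rV[k]_3) (X : {fset P2 k}).
Implicit Types (F G S : {mpoly k[3]}).

(** Vectors for the points of X, indexed by an arbitrary finite type so that the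
    configuration C can be indexed by pairs of lines. *)
Definition represents :=
  (forall i, p i != 0) /\ (forall P, P \in X <-> exists i, val P = <[p i]>%VS).

Hypothesis pX : represents.

Lemma point_of i : exists P, P \in X /\ val P = <[p i]>%VS.
Proof.
have dP : \dim <[p i]> == 1%N by rewrite dim_vline pX.1.
by exists (exist _ <[p i]>%VS dP); split=> //; apply/pX.2; exists i.
Qed.

Lemma set_ideal_homog F d : F \is d.-homog ->
  set_ideal X F <-> forall i, ev (p i) F = 0.
Proof.
move=> hF; split=> [IF i|F0 P /pX.2[i Pi]]; last exact/(pt_ideal_homog Pi hF).
by have [P [PX Pi]] := point_of i; apply/(pt_ideal_homog Pi hF)/IF.
Qed.

Lemma double_ideal_jet F : double_ideal X F ->
  forall i, ev (p i) F = 0 /\ grad (p i) F = 0.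
Proof.
by move=> IF i; have [P [PX Pi]] := point_of i; apply: (ideal_sqr_jet Pi); apply: IF.
Qed.

Lemma double_ideal_homog F d : F \is d.+1.-homog ->
  (forall i, ev (p i) F = 0 /\ grad (p i) F = 0) -> double_ideal X F.
Proof. by move=> hF F0 P /pX.2[i Pi]; apply/(ideal_sqr_homog Pi hF). Qed.

Lemma mem_set_piece t (F : dhomog 3 k t) : F \in graded_piece (set_ideal X) t <->
  forall i, ev (p i) (mpoly_of_dhomog F) = 0.
Proof.
rewrite (mem_graded_piece F (set_ideal_is_ideal X)).
exact: set_ideal_homog (dhomog_is_dhomog F).
Qed.

Lemma double_piece_jet t (F : dhomog 3 k t) : F \in graded_piece (double_ideal X) t ->
  forall i, ev (p i) (mpoly_of_dhomog F) = 0 /\ grad (p i) (mpoly_of_dhomog F) = 0.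
Proof. by move/(mem_graded_piece F (double_ideal_is_ideal X))/double_ideal_jet. Qed.

Lemma dim_multiples (I : {mpoly k[3]} -> Prop) d e S (K : {vspace dhomog 3 k e}) :
  is_ideal I -> S \is d.-homog -> S != 0 ->
  (forall G : dhomog 3 k e, G \in K -> I (S * mpoly_of_dhomog G)) ->
  (\dim K <= \dim (graded_piece I (d + e)))%N.
Proof.
move=> II hS nS KI.
pose f (G : dhomog 3 k e) : dhomog 3 k (d + e) :=
  DHomog (dhomog_mul hS (dhomog_is_dhomog G)).
apply: (@dim_le_injective _ _ _ f) => [c G H|G /KI IG|G _ /(congr1 (@mpoly_of_dhomog _ _ _))].
- by apply: val_inj; rewrite /= mulrDr scalerAr.
- exact/mem_graded_piece.
rewrite /= => /eqP; rewrite mulf_eq0 (negbTE nS) => /eqP G0.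
exact: val_inj.
Qed.

Lemma double_dim6 :
  (\dim (graded_piece (double_ideal X) 7) <= 5)%N ->
  (\dim (graded_piece (double_ideal X) 6) <= 2)%N.
Proof.
move=> d7; rewrite leqNgt; apply/negP => d6.
suff : (6 <= \dim (graded_piece (double_ideal X) 7))%N by lia.
apply: dim_linear_multiples d6 => F i FI.
have hG : 'X_i * mpoly_of_dhomog F \is 7.-homog.
  by apply: (dhomog_mul (d := 1) (e := 6)) (dhomog_is_dhomog F); rewrite dhomogX /= mdeg1.
exists (DHomog hG) => //; apply/(mem_graded_piece _ (double_ideal_is_ideal X)) => /=.
have [I0 IL] := double_ideal_is_ideal X; rewrite -[_ * _]addr0; apply: IL => //.
exact/(mem_graded_piece F (double_ideal_is_ideal X)).
Qed.

(** A nonzero F of degree t would give the multiples F G, with G of degree 6 - t,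
    a space of dimension at least 3 in degree 6. *)
Lemma double_dim5 t : (t <= 5)%N ->
  (\dim (graded_piece (double_ideal X) 6) <= 2)%N ->
  \dim (graded_piece (double_ideal X) t) = 0%N.
Proof.
move=> t5 d6; apply/eqP; rewrite dimv_eq0; apply: contraT => nI.
pose F := vpick (graded_piece (double_ideal X) t).
have FI : double_ideal X (mpoly_of_dhomog F).
  exact/(mem_graded_piece F (double_ideal_is_ideal X))/memv_pick.
have nF : mpoly_of_dhomog F != 0.
  by move: nI; rewrite -vpick0; apply: contra => F0; apply/eqP/val_inj/eqP.
have [I0 IL] := double_ideal_is_ideal X.
have : ('C(6 - t + 2, 2) <= \dim (graded_piece (double_ideal X) (t + (6 - t))))%N.
  rewrite -(dim_dhomog3 k).
  apply: (dim_multiples (double_ideal_is_ideal X) (dhomog_is_dhomog F) nF) => G _.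
  by rewrite mulrC -[_ * _]addr0; apply: IL.
rewrite subnKC ?(leq_trans t5) // => /leq_trans/(_ d6).
by move: t t5 {F FI nF nI I0 IL} => [|[|[|[|[|[|]]]]]].
Qed.

Hypothesis char0 : [pchar k] =i pred0.
Hypothesis card_T : #|T| = 11%N.
Hypothesis H3 : H_pts X 3 = 10%N.
Hypothesis H4 : H_pts X 4 = 11%N.

(** Here 10 is the dimension of the space of all cubics. *)
Lemma no_cubic_through F : F \is 3.-homog -> (forall j, ev (p j) F = 0) -> F = 0.
Proof.
move=> hF F0; have : DHomog hF \in graded_piece (set_ideal X) 3 by apply/mem_set_piece.
have : \dim (graded_piece (set_ideal X) 3) = 0%N.
  move: H3; rewrite /H_pts /hilbert dim_dhomog3 (_ : 'C(3 + 2, 2) = 10)%N //.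
  have := dimvS (subvf (graded_piece (set_ideal X) 3)).
  by rewrite dim_dhomog3 (_ : 'C(3 + 2, 2) = 10)%N //; lia.
move/eqP; rewrite dimv_eq0 => /eqP ->; rewrite memv0 => /eqP.
by move/(congr1 (@mpoly_of_dhomog _ _ _)); rewrite linear0.
Qed.

(** Otherwise the quartics through the ten other points, a space of dimension at
    least 5, would all pass through p_i, contrary to 15 - 11 = 4. *)
Lemma quartic_separators i : exists Q,
  [/\ Q \is 4.-homog, ev (p i) Q != 0 & forall j, j != i -> ev (p j) Q = 0].
Proof.
apply: contrapT => no.
have [|K KE] := @kernel_exists k (dhomog 3 k 4) {ffun {j | j != i} -> k^o}
  (fun F : dhomog 3 k 4 => [ffun j => ev (p (val j)) (mpoly_of_dhomog F)]).
  by move=> c F G; apply/ffunP => j; rewrite !ffunE linearP evD evZ.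
rewrite dim_ffun_scalar card_sig (cardC1 i) card_T dim_dhomog3 => dK.
have : (\dim K <= \dim (graded_piece (set_ideal X) 4))%N.
  apply/dimvS/subvP => F /KE F0; apply/mem_set_piece => j.
  have F0' l : l != i -> ev (p l) (mpoly_of_dhomog F) = 0.
    by move=> li; move/ffunP/(_ (Sub l li)): F0; rewrite !ffunE.
  have [->|/F0'//] := eqVneq j i; apply: contrapT => /eqP Fi; apply: no.
  by exists (mpoly_of_dhomog F); split=> //; apply: dhomog_is_dhomog.
move: H4 dK; rewrite /H_pts /hilbert dim_dhomog3 (_ : 'C(4 + 2, 2) = 15)%N //; lia.
Qed.

Lemma double_dim7 : (\dim (graded_piece (double_ideal X) 7) <= 5)%N.
Proof.
apply: (double_forms7 char0 card_T no_cubic_through quartic_separators).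
by move=> F /double_piece_jet F0 i; have [] := F0 i.
Qed.

Lemma double_dim8 : (\dim (graded_piece (double_ideal X) 8) <= 13)%N.
Proof.
apply: (double_forms8 char0 card_T no_cubic_through quartic_separators).
by move=> F /double_piece_jet F0 i; have [] := F0 i.
Qed.

Lemma double_dim9 t : (9 <= t)%N ->
  (33 + \dim (graded_piece (double_ideal X) t) <= 'C(t + 2, 2))%N.
Proof.
move=> t9; apply: (double_forms9 char0 card_T quartic_separators t9).
by move=> F /double_piece_jet F0 i; have [] := F0 i.
Qed.

End HilbertFunctions.

(** * The configuration C *)

Lemma line_equation (k : closedFieldType) (l : line k) :
  exists n : 'rV[k]_3, forall v, v \in val l <-> dot n v = 0.
Proof.
have dl : \dim (val l) = 2%N := eqP (valP l).
have [||n nn n0] := @kernel_nonzero k 'rV[k]_3 'rV[k]_(\dim (val l))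
  (fun n => \row_i dot n (vbasis (val l))`_i).
- by move=> c u v; apply/rowP => i; rewrite !mxE dotDl dotZl.
- by rewrite !dim_rV dl.
have ln v : v \in val l -> dot n v = 0.
  move=> /coord_vbasis ->; rewrite dot_sumr big1 // => i _.
  by move/rowP/(_ i): n0; rewrite dotZr !mxE => ->; rewrite mulr0.
exists n => v; split=> [/ln//|nv]; apply: contraT => vl.
have [e /eqP[]] := exists_dot_neq0 nn.
have : e \in (val l + <[v]>)%VS.
  suff /eqP -> : (val l + <[v]>)%VS == fullv by apply: memvf.
  rewrite eqEdim subvf dim_rV; suff : (\dim (val l) < \dim (val l + <[v]>))%N by rewrite dl.
  rewrite ltn_neqAle dimvS ?addvSl // andbT.
  apply: contra vl => dE; have /eqP -> : val l == (val l + <[v]>)%VS.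
    by rewrite eqEdim addvSl (eqP dE) /=.
  exact: (subvP (addvSr _ _)) (memv_line v).
by move=> /memv_addP[u /ln u0 [w /vlineP[c ->] ->]]; rewrite dotDr dotZr u0 nv mulr0 addr0.
Qed.

Lemma card_pairs6 (P : nat -> nat -> bool) :
  #|[pred x : 'I_6 * 'I_6 | P x.1 x.2]| = (\sum_(i < 6) \sum_(j < 6) P i j)%N.
Proof.
rewrite -sum1_card -(pair_big_dep xpredT (fun i j : 'I_6 => P i j) (fun _ _ => 1%N)) /=.
by apply: eq_bigr => i _; rewrite big_mkcond; apply: eq_bigr => j _; case: (P i j).
Qed.

Section Configuration.
Variables (k : closedFieldType) (C : {fset P2 k}) (L : 'I_6 -> line k) (m : 'I_6).
Hypothesis char0 : [pchar k] =i pred0.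
Hypothesis genL : general_lines L.
Hypothesis m5 : (m < 5)%N.
Hypothesis CE : forall P : P2 k, P \in C <->
  (exists i j : 'I_6, [/\ (i < j)%N, (j < 5)%N, on P (L i) & on P (L j)])
  \/ (on P (L ord_max) /\ on P (L m)).
Variable n : 'I_6 -> 'rV[k]_3.
Hypothesis nE : forall i v, v \in val (L i) <-> dot (n i) v = 0.

Implicit Types x y : 'I_6 * 'I_6.

(** The pairs i < j < 5 index the ten points L_i and L_j have in common, and the
    pair (m, 5) indexes the eleventh point, on L_m and on the sixth line. *)
Definition star (i j : nat) := (i < j)%N && (j < 5)%N.
Definition node (i j : nat) := star i j || (i == m) && (j == 5)%N.
Definition pairs (P : nat -> nat -> bool) := {x : 'I_6 * 'I_6 | P x.1 x.2}.
Local Notation T := (pairs node).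

Definition meet (x : 'I_6 * 'I_6) := (val (L x.1) :&: val (L x.2))%VS.

Lemma dim_meet x : x.1 != x.2 -> \dim (meet x) = 1%N.
Proof.
move=> x12; have d i : \dim (val (L i)) = 2%N := eqP (valP (L i)).
have := dimv_sum_cap (val (L x.1)) (val (L x.2)).
have := dimvS (subvf (val (L x.1) + val (L x.2))); rewrite dim_rV -/(meet x) !d.
suff : (\dim (meet x) < 2)%N by lia.
have le2 := dimvS (capvSl (val (L x.1)) (val (L x.2))); rewrite d in le2.
rewrite ltn_neqAle le2 andbT; apply: contra x12 => /eqP d2.
apply/eqP/(proj1 genL)/val_inj/eqP; rewrite /= eqEdim !d leqnn andbT.
have /eqP <- : meet x == val (L x.1) by rewrite eqEdim capvSl d d2.
exact: capvSr.
Qed.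

Definition pt (x : 'I_6 * 'I_6) : 'rV[k]_3 := vpick (meet x).

Lemma node_lt (x : 'I_6 * 'I_6) : node x.1 x.2 -> (x.1 < x.2)%N.
Proof.
by case/orP=> [/andP[]//|/andP[/eqP -> /eqP ->]].
Qed.

Lemma node_neq (x : 'I_6 * 'I_6) : node x.1 x.2 -> x.1 != x.2.
Proof. by move/node_lt => lt; apply: contraTneq lt => ->; rewrite ltnn. Qed.

Lemma meetE x : node x.1 x.2 -> meet x = <[pt x]>%VS.
Proof.
move=> /node_neq nx; apply/eqP; rewrite eq_sym eqEdim -memvE memv_pick.
by rewrite dim_vline dim_meet // vpick0 -dimv_eq0 dim_meet.
Qed.

Lemma pt_neq0 x : node x.1 x.2 -> pt x != 0.
Proof. by move=> /node_neq nx; rewrite vpick0 -dimv_eq0 dim_meet. Qed.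

Lemma on_meet x (P : P2 k) : node x.1 x.2 ->
  on P (L x.1) && on P (L x.2) = (val P == meet x).
Proof.
move=> nx; rewrite /on -subv_cap eqEdim (eqP (valP P)) dim_meet ?leqnn ?andbT //.
exact: node_neq.
Qed.

(** Generality of the lines: the point (i, j) is on no third line. *)
Lemma dot_pt x l : node x.1 x.2 -> (dot (n l) (pt x) == 0) = (l == x.1) || (l == x.2).
Proof.
move=> nx; have : pt x \in meet x := memv_pick _.
rewrite memv_cap => /andP[p1 p2].
apply/eqP/idP => [/nE pl|/orP[]/eqP ->]; last 2 first.
- exact/nE.
- exact/nE.
apply: contraT; rewrite negb_or => /andP[l1 l2].
have dP : \dim <[pt x]> == 1%N by rewrite dim_vline pt_neq0.
have := genL.2 x.1 x.2 l _ (exist _ <[pt x]>%VS dP).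
by rewrite /on /= -!memvE p1 p2 pl /= !inE negb_or (node_neq nx) (eq_sym _ l) l1 (eq_sym _ l) l2 => /(_ isT).
Qed.

Lemma C_represented : represents (fun t : T => pt (val t)) C.
Proof.
split=> [t|P]; first exact: pt_neq0 (valP t).
have to (x : 'I_6 * 'I_6) : node x.1 x.2 -> on P (L x.1) -> on P (L x.2) ->
    exists t : T, val P = <[pt (val t)]>%VS.
  move=> nx P1 P2; exists (Sub x nx); rewrite SubK -meetE //.
  by apply/eqP; rewrite -on_meet // P1.
split=> [/CE[[i [j [ij j5 Pi Pj]]]|[P5 Pm]]|[t Pt]].
- by apply: (to (i, j)); rewrite /node /star /= ?ij ?j5.
- by apply: (to (m, ord_max)); rewrite /node /star //= !eqxx orbT.
apply/CE; have nt := valP t; have := on_meet P nt.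
rewrite Pt meetE // eqxx => /andP[P1 P2].
case/orP: (nt) => [/andP[ij j5]|/andP[/eqP im /eqP j5]].
  by left; exists (val t).1, (val t).2.
right; have <- : (val t).2 = ord_max by apply: val_inj.
by have <- : (val t).1 = m by apply: val_inj.
Qed.

Lemma card_node : #|{: T}| = 11%N.
Proof.
rewrite card_sig (card_pairs6 node) /node /star !big_ord_recl !big_ord0 /=.
by case: m m5 => [[|[|[|[|[|]]]]]].
Qed.

Lemma card_star : #|{: pairs star}| = 10%N.
Proof. by rewrite card_sig (card_pairs6 star) /star !big_ord_recl !big_ord0. Qed.

Lemma node_on_m : #|{: pairs (fun i j => node i j && ((i == m) || (j == m)))}| = 5%N.
Proof.
rewrite card_sig (card_pairs6 (fun i j => node i j && ((i == m) || (j == m)))).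
rewrite /node /star !big_ord_recl !big_ord0 /=.
by case: m m5 => [[|[|[|[|[|]]]]]].
Qed.

Lemma node_off_m : #|{: pairs (fun i j => node i j && ~~ ((i == m) || (j == m)))}| = 6%N.
Proof.
rewrite card_sig (card_pairs6 (fun i j => node i j && ~~ ((i == m) || (j == m)))).
rewrite /node /star !big_ord_recl !big_ord0 /=.
by case: m m5 => [[|[|[|[|[|]]]]]].
Qed.

(** The two lines of y, which pass through pt y, must then be those of x. *)
Lemma node_inj x y : node x.1 x.2 -> node y.1 y.2 ->
  (forall l, l != x.1 -> l != x.2 -> dot (n l) (pt y) != 0) -> x = y.
Proof.
move=> nx ny h.
have yx l : (l == y.1) || (l == y.2) -> (l == x.1) || (l == x.2).
  rewrite -dot_pt // => ly; apply: contraT; rewrite negb_or => /andP[l1 l2].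
  by have := h l l1 l2; rewrite ly.
have := yx y.1; have := yx y.2; rewrite !eqxx orbT => /(_ isT) y2 /(_ isT) y1.
move: (node_lt nx) (node_lt ny) y1 y2; case: x y {nx ny h yx} => [x1 x2] [y1 y2] /=.
move=> ltx lty /orP[]/eqP e1 /orP[]/eqP e2; subst; rewrite ?ltnn // in lty *.
by have := ltn_trans ltx lty; rewrite ltnn.
Qed.

Lemma card_C : #|` C|%fset = 11%N.
Proof.
have d1 (t : T) : \dim (meet (val t)) == 1%N.
  by rewrite dim_meet //; apply: node_neq (valP t).
pose f (t : T) : P2 k := exist _ (meet (val t)) (d1 t).
have inj : injective f.
  move=> t u /(congr1 val) /= e; apply: val_inj; apply: node_inj (valP t) (valP u) _.
  move=> l l1 l2; have := dot_pt l (valP t); rewrite (negbTE l1) (negbTE l2) => /negbT.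
  by rewrite /pt e.
rewrite -card_node cardE -(size_map f); apply/perm_size/uniq_perm.
- exact: fset_uniq.
- by rewrite (map_inj_uniq inj) enum_uniq.
move=> P; apply/idP/mapP => [PC|[t _ ->]].
  have /(proj2 C_represented)[t Pt] : P \in C by [].
  by exists t; rewrite ?mem_enum //; apply: val_inj; rewrite /= Pt meetE //; apply: (valP t).
by apply/(proj2 C_represented); exists t; rewrite /= meetE //; apply: (valP t).
Qed.

Implicit Type A : {set 'I_6}.

Definition lines_prod (A : {set 'I_6}) : {mpoly k[3]} := \prod_(l in A) lin (n l).

Lemma lines_prod_homog A : lines_prod A \is #|A|.-homog.
Proof.
by apply: (dhomog_cast (muln1 _)); apply: dhomog_prod_const => l _; apply: lin_homog.
Qed.

Lemma ev_lines_prod A x : node x.1 x.2 -> x.1 \notin A -> x.2 \notin A ->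
  ev (pt x) (lines_prod A) != 0.
Proof.
move=> nx x1 x2; rewrite ev_prod; apply/prodf_neq0 => l lA.
rewrite ev_lin dot_pt // negb_or.
by apply/andP; split; [apply: contraNneq x1 => <- | apply: contraNneq x2 => <-].
Qed.

Lemma ev_lines_prod0 A x l : l \in A -> dot (n l) (pt x) = 0 ->
  ev (pt x) (lines_prod A) = 0.
Proof. by move=> lA lx; rewrite /lines_prod (bigD1 l) //= evM ev_lin lx mul0r. Qed.

Lemma node_separated x y : node x.1 x.2 -> node y.1 y.2 -> x != y ->
  exists l, [/\ l != x.1, l != x.2 & dot (n l) (pt y) = 0].
Proof.
move=> nx ny xy; apply: contrapT => no; case/eqP: xy; apply: node_inj => // l l1 l2.
by apply/negP => /eqP ly; apply: no; exists l.
Qed.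

(** The product of the four lines not through a point: another point of C lies on
    at least one of them. *)
Lemma C_quartic_separators (t : T) : exists Q,
  [/\ Q \is 4.-homog, ev (pt (val t)) Q != 0
    & forall u : T, u != t -> ev (pt (val u)) Q = 0].
Proof.
have nt := valP t; exists (lines_prod (~: [set (val t).1; (val t).2])); split.
- apply: (dhomog_cast _ (lines_prod_homog _)).
  by rewrite cardsCs setCK cards2 (node_neq nt) card_ord.
- by apply: ev_lines_prod => //; rewrite !inE eqxx ?orbT.
move=> u ut; have [|l [l1 l2 lu]] := node_separated nt (valP u).
  by rewrite eq_sym (inj_eq val_inj).
by apply: ev_lines_prod0 lu; rewrite !inE negb_or l1 l2.
Qed.

(** For the ten points on L_1, ..., L_5 the sixth line can be left out. *)
Lemma C_cubic_separators (t : pairs star) : exists Q,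
  [/\ Q \is 3.-homog, ev (pt (val t)) Q != 0
    & forall u : pairs star, u != t -> ev (pt (val u)) Q = 0].
Proof.
have st := valP t; have nt : node (val t).1 (val t).2 by apply/orP; left.
have [lt t5] := andP st.
exists (lines_prod (~: (ord_max |: [set (val t).1; (val t).2]))); split.
- apply: (dhomog_cast _ (lines_prod_homog _)).
  rewrite cardsCs setCK cardsU1 cards2 (node_neq nt) card_ord !inE.
  rewrite -!val_eqE /= !gtn_eqF //; exact: ltn_trans lt t5.
- by apply: ev_lines_prod => //; rewrite !inE eqxx ?orbT.
move=> u ut; have su := valP u; have nu : node (val u).1 (val u).2 by apply/orP; left.
have [|l [l1 l2 lu]] := node_separated nt nu.
  by rewrite eq_sym (inj_eq val_inj).
apply: ev_lines_prod0 (lu); rewrite !inE !negb_or l1 l2 !andbT.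
have [ltu u5] := andP su; move/eqP: lu; rewrite dot_pt // -!val_eqE /=.
by case/orP=> /eqP ->; rewrite ltn_eqF //; apply: ltn_trans ltu u5.
Qed.

(** The values at the ten points of the star are independent on cubics, a space of
    dimension 10. *)
Lemma dim_C_cubics : \dim (graded_piece (set_ideal C) 3) = 0%N.
Proof.
have := @independent_functionals k (dhomog 3 k 3) (pairs star)
  (fun t (F : dhomog 3 k 3) => ev (pt (val t)) (mpoly_of_dhomog F))
  (graded_piece (set_ideal C) 3).
rewrite card_star dim_dhomog3 => indep.
suff : (10 + \dim (graded_piece (set_ideal C) 3) <= 'C(3 + 2, 2))%N.
  by rewrite (_ : 'C(3 + 2, 2) = 10)%N //; lia.
apply: indep => [t c F G|F /(mem_set_piece C_represented) F0 t|c rel t].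
- by rewrite linearP evD evZ.
- have nt : node (val t).1 (val t).2 by apply/orP; left; apply: (valP t).
  exact: F0 (Sub (val t) nt : T).
have [Q [hQ Qt Qu]] := C_cubic_separators t.
have := rel (DHomog hQ); rewrite (bigD1 t) //= big1 => [|u ut]; last by rewrite Qu ?mulr0.
by rewrite addr0 => /eqP; rewrite mulf_eq0 (negbTE Qt) orbF => /eqP.
Qed.

(** Up to degree 3 no form passes through C, since its multiples by powers of a
    linear form reach degree 3. From degree 4 on the points are separated. *)
Lemma H_pts_C t : H_pts C t = H_gen 11 t.
Proof.
rewrite /H_pts /hilbert /H_gen dim_dhomog3.
have [t3|t4] := leqP t 3.
  have -> : \dim (graded_piece (set_ideal C) t) = 0%N.
    suff : (\dim (graded_piece (set_ideal C) t) <= \dim (graded_piece (set_ideal C) 3))%N.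
      by rewrite dim_C_cubics leqn0 => /eqP.
    have [e ne] : exists e : 'rV[k]_3, e != 0.
      exists (delta_mx 0 0); apply/eqP => /matrixP/(_ 0 0); rewrite !mxE => /eqP.
      by rewrite oner_eq0.
    have nS : lin e ^+ (3 - t) != 0 by rewrite expf_neq0 ?lin_eq0.
    have [I0 IL] := set_ideal_is_ideal C.
    have := @dim_multiples k _ _ _ _ (graded_piece (set_ideal C) t)
      (set_ideal_is_ideal C) (lin_exp_homog e (3 - t)) nS.
    rewrite subnK //; apply=> G /(mem_graded_piece G (set_ideal_is_ideal C)) GI.
    by rewrite -[_ * _]addr0; apply: IL.
  by rewrite subn0; case: t t3 => [|[|[|[|]]]].
have ub : ('C(t + 2, 2) <= \dim (graded_piece (set_ideal C) t) + 11)%N.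
  have [|K KE] := @kernel_exists k (dhomog 3 k t) {ffun T -> k^o}
    (fun F : dhomog 3 k t => [ffun u => ev (pt (val u)) (mpoly_of_dhomog F)]).
    by move=> c F G; apply/ffunP => u; rewrite !ffunE linearP evD evZ.
  rewrite dim_ffun_scalar card_node dim_dhomog3 => /leq_trans; apply.
  rewrite leq_add2r; apply/dimvS/subvP => F /KE F0.
  apply/(mem_set_piece C_represented) => u.
  by move/ffunP/(_ u): F0; rewrite !ffunE.
have := @independent_functionals k (dhomog 3 k t) T
  (fun u (F : dhomog 3 k t) => ev (pt (val u)) (mpoly_of_dhomog F))
  (graded_piece (set_ideal C) t).
rewrite card_node dim_dhomog3 => lb.
suff : (11 + \dim (graded_piece (set_ideal C) t) <= 'C(t + 2, 2))%N by lia.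
apply: lb => [u c F G|F /(mem_set_piece C_represented) //|c rel u].
  by rewrite linearP evD evZ.
have [Q [hQ Qu Qv]] := form_separates C_quartic_separators u t4.
have := rel (DHomog hQ); rewrite (bigD1 u) //= big1 => [|v vu]; last by rewrite Qv ?mulr0.
by rewrite addr0 => /eqP; rewrite mulf_eq0 (negbTE Qu) orbF => /eqP.
Qed.

Lemma lines_prod_neq0 A : lines_prod A != 0.
Proof.
apply/prodf_neq0 => l _; rewrite lin_eq0; apply/negP => /eqP nl0.
have := eqP (valP (L l)); suff -> : val (L l) = fullv by rewrite dim_rV.
by apply/eqP; rewrite eqEsubv subvf; apply/subvP => v _; apply/nE; rewrite nl0 dot0l.
Qed.

(** The product of L_1, ..., L_5 is double at the ten points of the star and passes
    through the eleventh point, so multiplying it by forms through the latter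
    gives forms double on C. *)
Lemma dim_C_double_multiples s :
  ('C(s + 2, 2) <= \dim (graded_piece (double_ideal C) (5 + s)) + 1)%N.
Proof.
(* The eleventh point. *)
pose e : 'I_6 * 'I_6 := (m, ord_max).
have ne : node e.1 e.2 by rewrite /node !eqxx orbT.
have [|K KE] := @kernel_exists k (dhomog 3 k s) k^o
  (fun F : dhomog 3 k s => ev (pt e) (mpoly_of_dhomog F)).
  by move=> c F G; rewrite linearP evD evZ.
rewrite dim_dhomog3 => /leq_trans; apply; rewrite [X in (_ + X <= _)%N]dimvf leq_add2r.
pose A := [set~ (ord_max : 'I_6)].
have cA : #|A| = 5%N by rewrite cardsC1 card_ord.
have hA : lines_prod A \is 5.-homog := dhomog_cast cA (lines_prod_homog A).
apply: (dim_multiples (double_ideal_is_ideal C) hA (lines_prod_neq0 A)) => G /KE Ge.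
apply: (double_ideal_homog C_represented (dhomog_mul hA (dhomog_is_dhomog G))) => u.
have nu := valP u; case/orP: (nu) => [/andP[lt u5]|/andP[/eqP um /eqP u5]].
  have l1 : (val u).1 \in A by rewrite !inE -val_eqE /= ltn_eqF // (ltn_trans lt).
  have l2 : (val u).2 \in A by rewrite !inE -val_eqE /= ltn_eqF.
  rewrite /lines_prod (bigD1 (val u).1) //= (bigD1 (val u).2) /=; last first.
    by rewrite l2 eq_sym (node_neq nu).
  apply/double_mulr/double_mul; rewrite ?evM ev_lin.
    by apply/eqP; rewrite dot_pt // eqxx.
  suff /eqP -> : dot (n (val u).2) (pt (val u)) == 0 by rewrite mul0r.
  by rewrite dot_pt // eqxx orbT.
have ue : val u = e.
  by rewrite [LHS]surjective_pairing; congr (_, _); apply: val_inj.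
apply: double_mul; last by rewrite ue.
apply: (@ev_lines_prod0 _ _ m); first by rewrite !inE -val_eqE /= ltn_eqF.
by apply/eqP; rewrite dot_pt // ue eqxx.
Qed.

(** The forms L_m G with G of degree 7, vanishing at the five points of C on L_m and
    double at the six others: 5 + 6 * 3 = 23 conditions, and 36 - 23 = 13. *)
Lemma dim_C_double8 : (13 <= \dim (graded_piece (double_ideal C) 8))%N.
Proof.
pose J := (pairs (fun i j => node i j && ((i == m) || (j == m))) +
  pairs (fun i j => node i j && ~~ ((i == m) || (j == m))) * 'I_3)%type.
have [|K KE] := @kernel_exists k (dhomog 3 k 7) {ffun J -> k^o}
  (fun F : dhomog 3 k 7 => [ffun c : J => match c with
     | inl x => ev (pt (val x)) (mpoly_of_dhomog F)
     | inr (x, r) => grad (pt (val x)) (mpoly_of_dhomog F) 0 r end]).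
  move=> c F G; apply/ffunP => -[x|[x r]]; rewrite !ffunE linearP.
    by rewrite evD evZ.
  by rewrite gradD gradZ !mxE.
rewrite dim_ffun_scalar card_sum card_prod node_on_m node_off_m card_ord dim_dhomog3.
rewrite (_ : 'C(7 + 2, 2) = 36)%N // => dK.
suff : (\dim K <= \dim (graded_piece (double_ideal C) (1 + 7)))%N.
  by apply: leq_trans; lia.
have nS : lin (n m) != 0.
  by have := lines_prod_neq0 [set m]; rewrite /lines_prod big_set1.
apply: (dim_multiples (double_ideal_is_ideal C) (lin_homog (n m)) nS) => G /KE G0.
apply: (double_ideal_homog C_represented (dhomog_mul (lin_homog _) (dhomog_is_dhomog G))) => u.
have nu := valP u.
have [um|um] := boolP (((val u).1 == m :> nat) || ((val u).2 == m :> nat)).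
  apply: double_mul.
    by rewrite ev_lin; apply/eqP; rewrite dot_pt // ![m == _]eq_sym -!val_eqE.
  have h : node (val u).1 (val u).2 && (((val u).1 == m :> nat) || ((val u).2 == m :> nat)).
    by rewrite nu um.
  by move/ffunP/(_ (inl (Sub (val u) h))): G0; rewrite !ffunE.
have h : node (val u).1 (val u).2 && ~~ (((val u).1 == m :> nat) || ((val u).2 == m :> nat)).
  by rewrite nu um.
have g0 : grad (pt (val u)) (mpoly_of_dhomog G) = 0.
  by apply/rowP => r; move/ffunP/(_ (inr (Sub (val u) h, r))): G0; rewrite !ffunE => ->; rewrite mxE.
by apply: double_mull; split=> //; apply: (ev_eq0_of_grad char0 _ g0); apply: dhomog_is_dhomog.
Qed.

Lemma dim_C_double_large t :
  ('C(t.+1 + 2, 2) <= \dim (graded_piece (double_ideal C) t.+1) + 33)%N.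
Proof.
have [|K KE] := @kernel_exists k (dhomog 3 k t.+1) {ffun T -> 'rV[k]_3}
  (fun F : dhomog 3 k t.+1 => [ffun u => grad (pt (val u)) (mpoly_of_dhomog F)]).
  by move=> c F G; apply/ffunP => u; rewrite !ffunE linearP gradD gradZ.
rewrite dim_ffun card_node dim_rV dim_dhomog3 => /leq_trans; apply.
rewrite leq_add2r; apply/dimvS/subvP => F /KE F0.
apply/(mem_graded_piece F (double_ideal_is_ideal C)).
apply: (double_ideal_homog C_represented (dhomog_is_dhomog F)) => u.
have g0 : grad (pt (val u)) (mpoly_of_dhomog F) = 0.
  by move/ffunP/(_ u): F0; rewrite !ffunE.
by split=> //; apply: (ev_eq0_of_grad char0 (dhomog_is_dhomog F) g0).
Qed.

Lemma H_double_C_minimal (X : {fset P2 k}) : chi_gen 11 X ->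
  forall t, (H_double C t <= H_double X t)%N.
Proof.
move=> [cX HX] t.
pose p (P : X) := vpick (val (val P)).
have pX : represents p X.
  split=> [P|P]; first by rewrite vpick0 -dimv_eq0 (eqP (valP (val P))).
  have pE (Q : P2 k) : val Q = <[vpick (val Q)]>%VS.
    apply/eqP; rewrite eq_sym eqEdim -memvE memv_pick dim_vline vpick0 -dimv_eq0.
    by rewrite (eqP (valP Q)).
  split=> [PX|[i Pi]]; first by exists [` PX]%fset; rewrite /p /= -pE.
  suff -> : P = val i by apply: valP.
  by apply: val_inj; rewrite Pi -pE.
have cT : #|{: X}| = 11%N by rewrite -cardfE.
have d7 := double_dim7 pX char0 cT (HX 3) (HX 4).
have d6 := double_dim6 d7.
rewrite /H_double /hilbert dim_dhomog3.
have [t5|t6] := leqP t 5; first by rewrite (double_dim5 t5 d6); lia.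
have [t9|t9] := leqP 9 t.
  have := double_dim9 pX char0 cT (HX 3) (HX 4) t9.
  by have := @dim_C_double_large t.-1; rewrite prednK; lia.
have : t \in [:: 6; 7; 8] by rewrite !inE; lia.
rewrite !inE => /or3P[]/eqP {t t6 t9} ->.
- apply/leq_sub2l/(leq_trans d6); rewrite -(leq_add2r 1); exact: dim_C_double_multiples 1.
- apply/leq_sub2l/(leq_trans d7); rewrite -(leq_add2r 1); exact: dim_C_double_multiples 2.
apply/leq_sub2l; apply: leq_trans dim_C_double8.
exact: double_dim8 pX char0 cT (HX 3) (HX 4).
Qed.

End Configuration.

Theorem mainTheorem1 (k : closedFieldType) (char0 : [pchar k]%R =i pred0)
    (C : {fset P2 k}) (hC : is_C51 C) :
  chi_gen 11 C /\
  forall X : {fset P2 k}, chi_gen 11 X ->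
    forall t : nat, (H_double C t <= H_double X t)%N.
Proof.
have [L [m [genL m5 CE]]] := hC.
have /choice[n nE] : forall i, exists n : 'rV[k]_3, forall v, v \in val (L i) <-> dot n v = 0.
  by move=> i; apply: line_equation.
split; last exact: (H_double_C_minimal char0 genL m5 CE nE).
split; first exact: (card_C genL m5 CE nE).
exact: (H_pts_C genL m5 CE nE).
Qed.
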